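(* Let $P\subseteq\mathbb{Z}^2$ with $|P|=4$. (1) If the four points of $P$ are in strict convex position, then $\mathsf{pdd}_P(\alpha)<\alpha^{5-\eta(\alpha)}$ for some function $\eta$ (depending on $P$) with $\eta(\alpha)\to0$ as $\alpha\to0$. (2) Otherwise, there is some $c=c_P>0$ such that $\mathsf{pdd}_P(\alpha)<\alpha^{c\log(1/\alpha)}$ for all $0<\alpha<1/2$.
   Context: Four points in $\mathbb{R}^2$ are in strict convex position if they are the vertices of a convex quadrilateral (no three collinear and none lies in the convex hull of the other three). Let $[N]=\{1,\dots,N\}$. For a finite $P\subseteq\mathbb{Z}^r$ and $0<\alpha<1$, the popular difference density $\mathsf{pdd}_P(\alpha)$ is the largest real number such that for every $\epsilon>0$ there exists $N_0=N_0(P,\epsilon)$ such that for every $N\ge N_0$ and every $A\subseteq[N]^r$ with $|A|\ge\alpha N^r$ there is some nonzero integer $d$ with $|\{x\in\mathbb{Z}^r : x+dy\in A \text{ for all } y\in P\}|\ge(\mathsf{pdd}_P(\alpha)-\epsilon)N^r$. *)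

(* Defs.v *)
From HB Require Import structures.
From mathcomp Require Import all_boot all_order all_algebra finmap lra.
From mathcomp Require Import all_classical all_reals all_analysis.

Set Implicit Arguments.
Unset Strict Implicit.
Unset Printing Implicit Defensive.
Import Order.TTheory GRing.Theory Num.Theory.
Import numFieldNormedType.Exports.
Local Open Scope classical_set_scope.
Local Open Scope ring_scope.

Section plane.
Variable R : realType.
Implicit Types S : {fset 'rV[R]_2}.

Definition collinear S : Prop :=
  exists (p v : 'rV[R]_2), v != 0 /\
    forall x, x \in S -> exists t : R, x = p + t *: v.

Definition conv_hull S : set 'rV[R]_2 :=
  [set x | exists w : 'rV[R]_2 -> R,
     [/\ forall y, y \in S -> 0 <= w y,
         \sum_(y <- S) w y = 1
       & x = \sum_(y <- S) w y *: y] ].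

(* Intended for #|` S| = 4. *)
Definition strict_convex_position S : Prop :=
  (forall T, (T `<=` S)%fset -> #|` T| = 3%N -> ~ collinear T) /\
  (forall x, x \in S -> ~ conv_hull (S `\ x)%fset x).

End plane.

Definition real_points (R : realType) (r : nat) (P : {fset 'rV[int]_r}) :
    {fset 'rV[R]_r} :=
  [fset map_mx intr p | p in P]%fset.

Section popular_difference.
Variables (R : realType) (r : nat).
Implicit Types (P A : {fset 'rV[int]_r}).

Definition in_grid (N : nat) A : Prop :=
  forall x, x \in A -> forall i, 1 <= x ord0 i <= N%:Z.

Definition dilate_translates P A (d : int) : set 'rV[int]_r :=
  [set x | forall y, y \in P -> x + d *: y \in A].

(* The set of translates is finite as soon as P is nonempty (see
   finite_dilate_translates below); fset_set sends infinite sets to fset0. *)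
Definition guaranteed_density P (alpha beta : R) : Prop :=
  forall eps : R, 0 < eps ->
  exists N0 : nat, forall N : nat, (N0 <= N)%N ->
  forall A, in_grid N A -> alpha * N%:R ^+ r <= #|` A|%:R ->
  exists2 d : int, d != 0 &
    (beta - eps) * N%:R ^+ r <= #|` fset_set (dilate_translates P A d)|%:R.

(* The supremum is a maximum for nonempty P and alpha <= 1: see pdd_max. *)
Definition pdd P (alpha : R) : R := sup [set beta | guaranteed_density P alpha beta].

End popular_difference.

Section pdd_is_maximum.
Variables (R : realType) (r : nat).
Implicit Types (P A : {fset 'rV[int]_r}).

Let sub_shift P A d (y : 'rV[int]_r) : y \in P ->
  dilate_translates P A d `<=` [set` [fset a - d *: y | a in A]%fset].
Proof.
move=> yP x /(_ _ yP) xA /=; apply/imfsetP; exists (x + d *: y) => //.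
by rewrite addrK.
Qed.

Lemma finite_dilate_translates P A d : P != fset0 ->
  finite_set (dilate_translates P A d).
Proof.
move=> /fset0Pn[y yP]; apply: sub_finite_set (sub_shift yP) _.
exact: finite_fset.
Qed.

Let card_translates P A d : P != fset0 ->
  (#|` fset_set (dilate_translates P A d)| <= #|` A|)%N.
Proof.
move=> P0; have /fset0Pn[y yP] := P0.
apply: leq_trans (_ : #|` [fset (a - d *: y)%R | a in A]%fset| <= _)%N.
  apply: fsubset_leq_card; apply/fsubsetP => x.
  by rewrite in_fset_set ?inE; [exact: sub_shift|exact: finite_dilate_translates].
exact: leq_imfset_card.
Qed.

Let grid N : {fset 'rV[int]_r} :=
  [fset (\row_i (Posz (f i).+1)) | f : {ffun 'I_r -> 'I_N} in predT]%fset.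

Let card_grid N : #|` grid N| = (N ^ r)%N.
Proof.
rewrite card_imfset /=.
  by rewrite -cardE card_ffun !card_ord.
move=> f g /rowP fg; apply/ffunP => i; apply: val_inj.
by have := fg i; rewrite !mxE => -[].
Qed.

Let in_grid_grid N : in_grid N (grid N).
Proof. by move=> x /imfsetP[f _ ->] i; rewrite mxE /= lez_nat ltn_ord. Qed.

Let guaranteed_density0 P (alpha : R) : guaranteed_density P alpha 0.
Proof.
move=> e e0; exists 0%N => N _ A _ _; exists 1 => //.
rewrite sub0r mulNr (@le_trans _ _ 0)// oppr_le0 mulr_ge0 ?exprn_ge0//.
exact: ltW.
Qed.

Let guaranteed_density_le1 P (alpha beta : R) : P != fset0 -> alpha <= 1 ->
  guaranteed_density P alpha beta -> beta <= 1.
Proof.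
move=> P0 a1 gb; apply/ler_addgt0Pr => e /gb[N0 /(_ N0.+1 (leqnSn _))].
move=> /(_ _ (@in_grid_grid _)); rewrite card_grid natrX.
have N0gt : 0 < (N0.+1%:R : R) ^+ r by rewrite exprn_gt0.
case=> [|d _ H]; first by rewrite ler_piMl// ltW.
rewrite -lerBlDr -(ler_pM2r N0gt) mul1r (le_trans H)//.
by rewrite -natrX -card_grid ler_nat card_translates.
Qed.

Lemma pdd_max P (alpha : R) : P != fset0 -> alpha <= 1 ->
  guaranteed_density P alpha (pdd P alpha) /\
  forall beta, guaranteed_density P alpha beta -> beta <= pdd P alpha.
Proof.
move=> P0 a1.
have ub : has_ubound [set b | guaranteed_density P alpha b].
  by exists 1 => b /=; exact: guaranteed_density_le1.
have hs : has_sup [set b | guaranteed_density P alpha b].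
  by split=> //; exists 0; exact: guaranteed_density0.
split; last by move=> b gb; exact: (ub_le_sup ub).
move=> e e0; have e20 : 0 < e / 2 by rewrite divr_gt0.
have [b gb lb] := sup_adherent e20 hs.
have [N0 HN] := gb _ e20; exists N0 => N /HN{}HN A gA cA.
have [d d0 H] := HN A gA cA; exists d => //; apply: le_trans H.
apply: ler_wpM2r; first exact: exprn_ge0.
by move: lb; rewrite -/(pdd P alpha); lra.
Qed.

End pdd_is_maximum.

(* Main.v *)
(** Only infinitely many [N] matter, so take [N = p - 1] with [p] prime and let [A] be cut
    out of [1, N]^2 by a polynomial condition modulo [p]; then every [d] that matters is a
    unit, and a shift of the condition gives [A] at least its expected density.

    If [P] is not in strict convex position, some point [p0] of [P] satisfies
    [sum a_i (p_i - p0) = 0] with integers [a_i >= 0], not all zero. There is a quadratic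
    form [q] with [sum a_i q (p_i - p0) = 0], hence
    [sum a_i q (x + d p_i) = (sum a_i) q (x + d p0)] for all [x] and [d]. Let [A] be the set
    where [q] lies in a Behrend-type set avoiding this convex relation. Then
    [q (x + d p1) - q (x + d p0)], a nonconstant affine function of [x], is confined to a
    short interval.

    If no three points of [P] are collinear, let [h], [u], [v] be powers of the linear forms
    constant along [p1 p2], [p2 p3], [p1 p3], and let [A] be given by
    [h + u + v] in a short interval and [2 h + u] in a Behrend-type set. The values of
    [2 h + u] at [x + d p1], [x + d p2], [x + d p3] form a perturbed three-term progression,
    so the three are close to each other (the Ruzsa-Szemeredi construction). This leaves five
    polynomial conditions on [x], each of probability about the density of [A]: the condition
    [h + u + v] at the four points, and one closeness condition. Weyl's inequality shows that
    they are asymptotically independent, uniformly in [d]. *)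

Require Import Defs.
From mathcomp Require Import all_boot all_order all_algebra all_field finmap.
From mathcomp Require Import all_classical all_reals all_analysis.
From mathcomp Require Import ring lra zify.
Set Implicit Arguments.
Unset Strict Implicit.
Unset Printing Implicit Defensive.
Import Order.TTheory GRing.Theory Num.Theory.
Import numFieldNormedType.Exports.
Local Open Scope ring_scope.

(** * Weyl sums over prime fields *)

Lemma coef_linear_exp (F : comNzRingType) (l b : F) (n k : nat) :
  ((l *: 'X + b%:P) ^+ n)`_k = (b ^+ (n - k) * l ^+ k) *+ 'C(n, k).
Proof.
rewrite addrC exprDn coef_sum.
under eq_bigr => i _.
  rewrite coefMn exprZn -polyC_exp mulrC -scalerAl coefZ mulrC coefMC coefXn.
  over.
have [lt_nk|le_kn] := ltnP n k.
  rewrite bin_small ?mulr0n// big1// => i _.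
  by rewrite gtn_eqF ?mul0r ?mul0rn //; apply: leq_ltn_trans lt_nk; rewrite -ltnS.
rewrite (bigD1 (inord k)) //= big1 ?addr0 => [|i ik].
  by rewrite inordK // eqxx mul1r.
suff -> : (k == i :> nat) = false by rewrite !mul0r mul0rn.
by apply: contraNF ik => /eqP ->; rewrite inord_val.
Qed.

Lemma val_Fp_lt (p : nat) (x : 'F_p) : prime p -> (x < p)%N.
Proof. by move=> pp; apply: leq_trans (ltn_ord x) _; rewrite Fp_cast. Qed.

Lemma natr_Fp_val (p : nat) (x : 'F_p) : (x : nat)%:R = x.
Proof. exact: natr_Zp. Qed.

Lemma natr_Fp_eq0 (p n : nat) : prime p -> (n%:R == 0 :> 'F_p) = (p %| n)%N.
Proof. by move=> pp; rewrite (dvdn_pcharf (pchar_Fp pp)). Qed.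

Lemma natr_Fp_neq0 (p n : nat) : prime p -> (0 < n < p)%N -> n%:R != 0 :> 'F_p.
Proof. by move=> pp /andP[n0 np]; rewrite natr_Fp_eq0 // gtnNdvd. Qed.

Section Weyl.
Variables (p : nat) (z : algC).
Hypotheses (pp : prime p) (zP : p.-primitive_root z).

(** The additive character of ['F_p] attached to [z]. Its values lie in [algC], where primitive
    roots of unity of every order exist. *)
Definition expi (x : 'F_p) : algC := z ^+ (x : nat).

Lemma expi_nat n : expi n%:R = z ^+ n.
Proof. by rewrite /expi (val_Fp_nat pp) prim_expr_mod. Qed.

Lemma expiD x y : expi (x + y) = expi x * expi y.
Proof. by rewrite -[x]natr_Fp_val -[y]natr_Fp_val -natrD !expi_nat exprD. Qed.

Lemma expi0 : expi 0 = 1.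
Proof. by rewrite /expi expr0. Qed.

Lemma norm_expi x : `|expi x| = 1.
Proof.
rewrite /expi normrX.
suff -> : `|z| = 1 by rewrite expr1n.
by apply/eqP; rewrite -(@pexpr_eq1 _ _ p) ?prime_gt0 // -normrX prim_expr_order ?normr1.
Qed.

Lemma conj_expi x : (expi x)^* = expi (- x).
Proof.
have nz : expi x != 0 by rewrite -normr_eq0 norm_expi oner_eq0.
apply: (mulfI nz); rewrite -normCK norm_expi expr1n -expiD subrr expi0 //.
Qed.

Lemma sum_expi a : \sum_(x : 'F_p) expi (a * x) = if a == 0 then p%:R else 0.
Proof.
have [->|a0] := eqVneq a 0.
  under eq_bigr do rewrite mul0r expi0.
  by rewrite sumr_const card_Fp.
set S := (LHS).
have SE : S = expi 1 * S.
  rewrite /S [in LHS](reindex_inj (addrI a^-1)) /= mulr_sumr.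
  by apply: eq_bigr => x _; rewrite mulrDr mulfV // expiD.
have : (expi 1 - 1) * S = 0 by rewrite mulrBl mul1r -SE subrr.
have e1 : expi 1 = z by rewrite -[X in expi X]/(1%:R) expi_nat expr1.
move/eqP; rewrite mulf_eq0 subr_eq0 e1 => /orP[z1|/eqP //].
have := prim_order_dvd zP 1; rewrite expr1 z1 dvdn1 => /eqP p1.
by move: pp; rewrite p1.
Qed.

(* van der Corput differencing *)
Lemma norm_sum_expi_sqr (f : 'F_p -> 'F_p) :
  `|\sum_x expi (f x)| ^+ 2 <= \sum_h `|\sum_x expi (f (x + h) - f x)|.
Proof.
have E : `|\sum_x expi (f x)| ^+ 2 = \sum_h \sum_x expi (f (x + h) - f x).
  rewrite normCK rmorph_sum /= mulr_sumr [RHS]exchange_big /=.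
  apply: eq_bigr => x _; rewrite mulr_suml (reindex_inj (addrI x)) /=.
  by apply: eq_bigr => h _; rewrite conj_expi expiD.
rewrite -[leLHS]ger0_norm ?exprn_ge0 // E; exact: ler_norm_sum.
Qed.

End Weyl.

Definition shift_diff (F : fieldType) (h : F) (Q : {poly F}) :=
  Q \Po ('X + h%:P) - Q.

Lemma horner_shift_diff (F : fieldType) (h : F) Q x :
  (shift_diff h Q).[x] = Q.[x + h] - Q.[x].
Proof. by rewrite /shift_diff hornerD hornerN horner_comp !hornerE. Qed.

(** The leading terms cancel, and the next coefficient is [(d + 1) h] times the leading coefficient
    of [Q]. Thus differencing lowers the degree by exactly one. *)
Lemma size_shift_diff (F : fieldType) (h : F) (Q : {poly F}) (d : nat) :
  size Q = d.+2 -> d.+1%:R != 0 :> F -> h != 0 ->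
  size (shift_diff h Q) = d.+1.
Proof.
move=> sQ d0 h0.
have cE k : (Q \Po ('X + h%:P))`_k =
    \sum_(i < d.+2) Q`_i * (h ^+ (i - k)) *+ 'C(i, k).
  rewrite comp_polyE sQ coef_sum; apply: eq_bigr => i _.
  rewrite coefZ -[X in (X + _) ^+ _]scale1r coef_linear_exp expr1n mulr1.
  by rewrite mulrnAr.
have lQ : Q`_d.+1 != 0.
  have -> : Q`_d.+1 = lead_coef Q by rewrite lead_coefE sQ.
  by rewrite lead_coef_eq0 -size_poly_eq0 sQ.
apply/eqP; rewrite eqn_leq; apply/andP; split.
  apply/leq_sizeP => j; rewrite leq_eqVlt => /orP[/eqP <-|jd].
    rewrite coefB cE big_ord_recr /= big1 => [|i _].
      by rewrite add0r subnn expr0 mulr1 binn mulr1n subrr.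
    by rewrite bin_small // mulr0n.
  rewrite coefB cE big1 => [|i _].
    by rewrite sub0r nth_default ?oppr0 // sQ.
  by rewrite bin_small ?mulr0n //; exact: leq_trans jd.
rewrite ltnNge; apply/negP => /leq_sizeP /(_ d (leqnn _)) /eqP.
rewrite coefB cE big_ord_recr big_ord_recr /= big1 => [|i _]; last first.
  by rewrite bin_small.
rewrite add0r subnn expr0 mulr1 binn mulr1n addrAC subrr add0r subSnn expr1.
by rewrite binSn -mulr_natr !mulf_eq0 (negPf lQ) (negPf h0) (negPf d0).
Qed.

(** Induction on the degree: differencing bounds the squared sum by [p], from [h = 0], plus sums of
    polynomials of lower degree. The saving is an arbitrary fixed factor [n], with [p0] depending on
    [D] and [n] only, hence uniform in [Q]. *)
Lemma weyl_sum_small (D n : nat) : exists p0 : nat,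
  forall (p : nat) (z : algC), prime p -> (p0 <= p)%N -> p.-primitive_root z ->
  forall Q : {poly 'F_p}, (1 < size Q <= D.+1)%N ->
  n%:R * `|\sum_x expi z Q.[x]| <= p%:R.
Proof.
elim: D n => [|D IH] n.
  by exists 0%N => p z _ _ _ Q /andP[h1 /(leq_trans h1)]; rewrite ltnn.
(* The squared sum has to be at most [p^2 / n^2]; the terms with [h = 0] and those with [h != 0]
   take half of this each. *)
have [p1 Hp1] := IH (2 * n ^ 2)%N.
exists (p1 + D.+3 + 2 * n ^ 2)%N => p z pp pge zP Q /andP[Q1 QD].
(* Differencing a linear polynomial leaves a constant, so this case is done directly: a nontrivial
   character sums to zero. *)
have [Q2|Q2] := eqVneq (size Q) 2%N.
  have QE x : Q.[x] = Q`_0 + Q`_1 * x.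
    by rewrite horner_coef Q2 !big_ord_recl big_ord0 /= expr0 expr1 mulr1 addr0.
  under eq_bigr do rewrite QE expiD //.
  rewrite -mulr_sumr sum_expi // ifF ?mulr0 ?normr0 ?mulr0 //.
  apply/negbTE; have -> : Q`_1 = lead_coef Q by rewrite lead_coefE Q2.
  by rewrite lead_coef_eq0 -size_poly_eq0 Q2.
have [d sQ] : exists d, size Q = d.+3.
  by case: (size Q) Q1 Q2 => [|[|[|d]]] // _ _; exists d.
rewrite -(@ler_pXn2r _ 2) ?nnegrE ?mulr_ge0 ?ler0n // exprMn.
have S1 : `|\sum_x expi z Q.[x]| ^+ 2 <=
    p%:R + \sum_(h | h != 0) `|\sum_x expi z (shift_diff h Q).[x]|.
  apply: le_trans (norm_sum_expi_sqr pp zP _) _.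
  rewrite (bigD1 0) //= lerD //.
    under eq_bigr do rewrite addr0 subrr expi0 //.
    by rewrite sumr_const card_Fp // normr_nat.
  apply: ler_sum => h _; rewrite le_eqVlt; apply/orP; left; apply/eqP.
  by congr (`| _ |); apply: eq_bigr => x _; rewrite horner_shift_diff.
have S2 : (2 * n ^ 2)%:R * (\sum_(h : 'F_p | h != 0)
     `|\sum_x expi z (shift_diff h Q).[x]|) <= p%:R * p%:R.
  rewrite mulr_sumr; apply: le_trans (_ : \sum_(h : 'F_p | h != 0) (p%:R : algC) <= _).
    apply: ler_sum => h h0; apply: Hp1 => //.
      by apply: leq_trans pge; rewrite -addnA leq_addr.
    rewrite (@size_shift_diff _ h Q d.+1 sQ) //; last first.
      rewrite natr_Fp_neq0 //=; move: QD; rewrite sQ => QD.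
      apply: leq_trans pge; rewrite -addnA addnC -addnA.
      by rewrite (leq_trans _ (leq_addr _ _)) // ltnW.
    by move: QD; rewrite sQ ltnS.
  rewrite sumr_const -[leLHS]mulr_natr -!natrM ler_nat leq_mul2l.
  by rewrite (leq_trans (max_card _)) ?orbT ?card_Fp.
have S3 : (2 * n ^ 2)%:R * (p%:R : algC) <= p%:R * p%:R.
  by rewrite -!natrM ler_nat leq_mul2r (leq_trans _ pge) ?orbT // leq_addl.
rewrite -natrX -(@ler_pM2l _ 2) ?ltr0n // mulrA -natrM.
apply: le_trans (ler_wpM2l (ler0n _ _) S1) _.
rewrite mulrDr mulrDl mul1r expr2; exact: lerD.
Qed.

(** * Equidistribution of polynomial values in short intervals *)

Section Equidistribution.
Variables (p : nat) (z : algC).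
Hypotheses (pp : prime p) (zP : p.-primitive_root z).
Variable J : {set 'F_p}.

(** This replaces the indicator function of an interval, because its Fourier coefficients [c k] are
    nonnegative and their sum is known exactly. *)
Definition autocorr (g : 'F_p) : nat := #|[set a in J | a + g \in J]|.

Let c (k : 'F_p) : algC := `|\sum_(a in J) expi z (k * a)| ^+ 2.

Let c_ge0 k : 0 <= c k.
Proof. exact: exprn_ge0. Qed.

Let c0 : c 0 = #|J|%:R ^+ 2.
Proof.
rewrite /c; under eq_bigr do rewrite mul0r expi0.
by rewrite sumr_const normr_nat.
Qed.

(** Fourier inversion: the square in [c k] expands over pairs [a], [b] in [J], and orthogonality of
    characters keeps those with [b = a + g]. *)
Lemma autocorr_fourier g :
  p%:R * (autocorr g)%:R = \sum_k c k * expi z (k * g).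
Proof.
have -> : \sum_k c k * expi z (k * g) =
    \sum_(a in J) \sum_(b in J) \sum_k expi z ((a + g - b) * k).
  under eq_bigr do rewrite /c normCK rmorph_sum /= mulr_suml mulr_suml.
  rewrite exchange_big /=; apply: eq_bigr => a _.
  under eq_bigr do rewrite mulr_sumr mulr_suml.
  rewrite exchange_big /=; apply: eq_bigr => b _; apply: eq_bigr => k _.
  by rewrite (conj_expi pp zP) -!expiD //; congr expi; ring.
under eq_bigr => a _ do under eq_bigr => b _ do rewrite (sum_expi pp zP) subr_eq0.
rewrite /autocorr -sum1dep_card natr_sum mulr_sumr big_mkcondr /=.
apply: eq_bigr => a _; case: ifP => [agJ|agJ].
  rewrite (bigD1 (a + g)) //= eqxx big1 ?addr0 ?mulr1 // => b /andP[_].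
  by rewrite eq_sym => /negPf ->.
by rewrite big1 // => b bJ; case: eqP => // E; rewrite E bJ in agJ.
Qed.

(** Parseval, read off from Fourier inversion at [g = 0]. *)
Let sum_c : \sum_k c k = p%:R * #|J|%:R.
Proof.
have := autocorr_fourier 0; under eq_bigr do rewrite mulr0 expi0 mulr1.
move=> <-; congr (_ * _%:R); apply: eq_card => a.
by rewrite !inE addr0 andbb.
Qed.

(* The Fourier coefficients of [autocorr] are nonnegative, so the nonzero frequencies cost
   at most [prod_j sum_k c k] times the largest exponential sum. *)
Lemma sum_prod_autocorr_le (I : finType) (G : I -> {poly 'F_p}) (n : nat) :
  (forall k : {ffun I -> 'F_p}, k != [ffun=> 0] ->
     n%:R * `|\sum_x expi z (\sum_j k j *: G j).[x]| <= p%:R) ->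
  (n * p ^ #|I| * (\sum_t \prod_j autocorr (G j).[t]) <=
   n * (#|J| ^ 2) ^ #|I| * p + (p * #|J|) ^ #|I| * p)%N.
Proof.
move=> hW; rewrite -(ler_nat algC) natrD !natrM !natrX natr_sum natrM.
(* Multiplying out the Fourier expansions of all factors gives one exponential sum for each
   frequency vector [k]. *)
have E : (p%:R : algC) ^+ #|I| * (\sum_t (\prod_j autocorr (G j).[t])%:R) =
   \sum_(k : {ffun I -> 'F_p}) (\prod_j c (k j)) *
     \sum_x expi z (\sum_j k j *: G j).[x].
  under [RHS]eq_bigr do rewrite mulr_sumr.
  rewrite exchange_big /= mulr_sumr; apply: eq_bigr => t _.
  rewrite natr_prod -prodr_const -big_split /=.
  under eq_bigr do rewrite autocorr_fourier.
  rewrite bigA_distr_bigA /=; apply: eq_bigr => k _.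
  rewrite big_split /=; congr (_ * _).
  rewrite horner_sum.
  under [in RHS]eq_bigr do rewrite hornerZ.
  apply/esym; apply: (big_morph (expi z)); last by rewrite expi0.
  by move=> x y; rewrite expiD.
have L0 : 0 <= n%:R * (p%:R ^+ #|I| *
    \sum_t (\prod_j autocorr (G j).[t])%:R) :> algC.
  by rewrite -natr_sum -natrX -!natrM ler0n.
rewrite -mulrA -(ger0_norm L0) E mulr_sumr.
apply: le_trans (ler_norm_sum _ _ _) _.
under eq_bigr do rewrite !normrM normr_nat (ger0_norm (prodr_ge0 _ _)) //
  mulrCA.
rewrite (bigD1 [ffun=> 0]) //=; apply: lerD.
  rewrite mulrCA -mulrA ler_wpM2l ?ler0n //.
  rewrite (eq_bigr (fun=> #|J|%:R ^+ 2)) => [|j _]; last by rewrite ffunE c0.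
  rewrite prodr_const (eq_bigr (fun=> 1)) => [|x _]; last first.
    by rewrite big1 ?horner0 ?expi0 // => j _; rewrite ffunE scale0r.
  by rewrite sumr_const card_Fp // normr_nat.
apply: le_trans (_ : \sum_(k : {ffun I -> 'F_p}) (\prod_j c (k j)) * p%:R <= _).
  rewrite [leRHS](bigD1 [ffun=> 0]) //=.
  apply: le_trans (_ : \sum_(k : {ffun I -> 'F_p} | k != [ffun=> 0])
      (\prod_j c (k j)) * p%:R <= _); last first.
    by rewrite lerDr mulr_ge0 // prodr_ge0.
  by apply: ler_sum => k k0; rewrite ler_wpM2l ?prodr_ge0 // hW.
rewrite -mulr_suml -(bigA_distr_bigA (fun=> c)) /= ler_wpM2r ?ler0n //.
by rewrite prodr_const sum_c.
Qed.

End Equidistribution.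

Lemma card_Fp_lt (p m : nat) : prime p -> (m <= p)%N ->
  #|[set x : 'F_p | (x < m)%N]| = m.
Proof.
move=> pp mp.
have -> : [set x : 'F_p | (x < m)%N] = [set (i : nat)%:R | i : 'I_m].
  apply/setP => x; rewrite inE; apply/idP/imsetP => [xm|[i _ ->]].
    by exists (Ordinal xm) => //=; rewrite natr_Fp_val.
  by rewrite val_Fp_nat // modn_small // (leq_trans _ mp).
rewrite card_imset ?card_ord // => i j /(congr1 (fun x : 'F_p => x : nat)).
by rewrite /= !val_Fp_nat // !modn_small ?(leq_trans _ mp) // => /val_inj.
Qed.

(** Every [a < m] has [a + g < 2 m] without wrapping modulo [p]. Hence [autocorr] divided by [m]
    majorizes the indicator function of the residues below [m]. *)
Lemma autocorr_interval_ge (p m : nat) (g : 'F_p) : prime p ->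
  (2 * m <= p)%N -> (g < m)%N ->
  (m <= autocorr [set x : 'F_p | (x < 2 * m)%N] g)%N.
Proof.
move=> pp mp gm.
rewrite -[X in (X <= _)%N](@card_Fp_lt p m pp); last by lia.
apply: subset_leq_card; apply/fintype.subsetP => a; rewrite !inE => am.
rewrite -[a]natr_Fp_val -[g]natr_Fp_val -natrD val_Fp_nat // val_Fp_nat //.
by rewrite !modn_small; lia.
Qed.

(** The bound reads [|Z| <= p (4 m / p)^r + 2^r p / n]: up to constants the [r] conditions are
    independent, and a large [n] beats the error once [m / p] is bounded below. *)
Lemma interval_equidistribution (D r n : nat) : exists p0 : nat,
  forall (p : nat), prime p -> (p0 <= p)%N ->
  forall (G : 'I_r -> {poly 'F_p}) (m : nat) (Z : {set 'F_p}),
  (forall k : {ffun 'I_r -> 'F_p}, k != [ffun=> 0] ->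
     (1 < size (\sum_j k j *: G j)%R <= D.+1)%N) ->
  (2 * m <= p)%N ->
  (forall t j, t \in Z -> ((G j).[t] < m)%N) ->
  (n * p ^ r * (#|Z| * m ^ r) <=
   n * ((2 * m) ^ 2) ^ r * p + (p * (2 * m)) ^ r * p)%N.
Proof.
have [p0 Hp0] := weyl_sum_small D n.
exists p0 => p pp pp0 G m Z hG mp hZ.
have [z zP] := C_prim_root_exists (prime_gt0 pp).
have := @sum_prod_autocorr_le p z pp zP [set x : 'F_p | (x < 2 * m)%N] _ G n.
rewrite card_ord card_Fp_lt //.
move=> /(_ (fun k k0 => Hp0 p z pp pp0 zP _ (hG k k0))); apply: leq_trans.
rewrite leq_mul2l; apply/orP; right.
rewrite -sum_nat_const big_mkcond /=; apply: leq_sum => t _.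
case: ifP => // tZ.
rewrite -[X in (_ ^ X)%N]card_ord -prod_nat_const.
by apply: leq_prod => j _; apply: autocorr_interval_ge => //; apply: hZ.
Qed.

(** * Behrend sets *)

Lemma pigeonhole_fiber (T : finType) (f : T -> nat) (n : nat) :
  (0 < n)%N -> (forall x, f x < n)%N ->
  exists y, (#|T| <= n * #|[set x | f x == y]|)%N.
Proof.
move=> n0 fn; apply: contrapT => /forallNP H.
have /negP := ltnn (\sum_(y < n) #|T|); apply.
apply: leq_ltn_trans (_ : \sum_(y < n) n * #|[set x | f x == y]| < _)%N.
  rewrite -big_distrr /= sum_nat_const card_ord leq_mul2l; apply/orP; right.
  rewrite -sum1_card (partition_big (fun x => Ordinal (fn x)) xpredT) //=.
  apply: leq_sum => y _; rewrite sum1dep_card; apply: subset_leq_card.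
  by apply/fintype.subsetP => x; rewrite !inE => /eqP <-.
case: n n0 {fn} H => // n _ H.
rewrite !big_ord_recl -addSn leq_add //; first by rewrite ltnNge; apply/negP/H.
by apply: leq_sum => y _; rewrite ltnW // ltnNge; apply/negP/H.
Qed.

Definition digits_value (b D : nat) (v : 'I_D -> nat) : nat :=
  \sum_(i < D) v i * b ^ i.

Lemma digits_valueS b D (v : 'I_D.+1 -> nat) :
  digits_value b v = (v ord0 + b * digits_value b (fun i => v (lift ord0 i)))%N.
Proof.
rewrite /digits_value big_ord_recl expn0 muln1 big_distrr /=; congr addn.
by apply: eq_bigr => i _; rewrite /bump /= add1n expnS mulnCA.
Qed.

Lemma digits_value_lt b D (v : 'I_D -> nat) :
  (forall i, v i < b)%N -> (digits_value b v < b ^ D)%N.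
Proof.
elim: D v => [|D IH] v vb; first by rewrite /digits_value big_ord0.
rewrite digits_valueS expnS.
have := IH _ (fun i => vb (lift ord0 i)); have := vb ord0.
set d := digits_value _ _ => v0 dlt.
apply: leq_trans (_ : b + b * d <= _)%N; first by rewrite ltn_add2r.
by rewrite -mulnS leq_mul2l dlt orbT.
Qed.

Lemma digits_value_inj b D (v v' : 'I_D -> nat) :
  (forall i, v i < b)%N -> (forall i, v' i < b)%N ->
  digits_value b v = digits_value b v' -> v =1 v'.
Proof.
elim: D v v' => [|D IH] v v' vb vb' E; first by case.
move: E; rewrite !digits_valueS => E.
have b0 : (0 < b)%N by apply: leq_ltn_trans (vb ord0).
have E0 : v ord0 = v' ord0.
  have := congr1 (modn^~ b) E.
  by rewrite /= ![(b * _)%N]mulnC ![(_ + _ * b)%N]addnC !modnMDl !modn_small.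
move: E; rewrite E0 => /addnI /eqP; rewrite eqn_pmul2l // => /eqP E1 i.
case: (unliftP ord0 i) => [j ->|-> //].
exact: (IH _ _ (fun i => vb (lift ord0 i)) (fun i => vb' (lift ord0 i)) E1).
Qed.

(** The linear relation turns [sum_j a_j |v_j - v0|^2] into [sum_j a_j |v_j|^2 - (a1 + a2 + a3)
    |v0|^2], which is 0 on a sphere. All its terms are nonnegative, so they vanish. *)
Lemma sphere_strictly_convex (D a1 a2 a3 rho : nat) (v0 v1 v2 v3 : 'I_D -> nat) :
  (0 < a1)%N ->
  (forall i, a1 * v1 i + a2 * v2 i + a3 * v3 i = (a1 + a2 + a3) * v0 i)%N ->
  (\sum_i v0 i ^ 2 = rho)%N -> (\sum_i v1 i ^ 2 = rho)%N ->
  (\sum_i v2 i ^ 2 = rho)%N -> (\sum_i v3 i ^ 2 = rho)%N -> v1 =1 v0.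
Proof.
move=> a10 lin n0 n1 n2 n3.
have toZ (v : 'I_D -> nat) : (\sum_i v i ^ 2 = rho)%N ->
    \sum_i (v i)%:Z ^+ 2 = rho%:Z.
  move=> <-; rewrite -[RHS]natz natr_sum; apply: eq_bigr => i _.
  by rewrite natrX natz.
have nn (a : nat) (v : 'I_D -> nat) i : 0 <= a%:Z * ((v i)%:Z - (v0 i)%:Z) ^+ 2.
  by rewrite mulr_ge0 // sqr_ge0.
pose t i := a1%:Z * ((v1 i)%:Z - (v0 i)%:Z) ^+ 2 +
            a2%:Z * ((v2 i)%:Z - (v0 i)%:Z) ^+ 2 +
            a3%:Z * ((v3 i)%:Z - (v0 i)%:Z) ^+ 2.
have t0 i : 0 <= t i by rewrite !addr_ge0.
have tE i : t i = a1%:Z * (v1 i)%:Z ^+ 2 + a2%:Z * (v2 i)%:Z ^+ 2 +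
    a3%:Z * (v3 i)%:Z ^+ 2 - (a1%:Z + a2%:Z + a3%:Z) * (v0 i)%:Z ^+ 2.
  have /(congr1 Posz) := lin i; rewrite !(PoszD, PoszM) => L.
  rewrite /t.
  transitivity (a1%:Z * (v1 i)%:Z ^+ 2 + a2%:Z * (v2 i)%:Z ^+ 2 +
    a3%:Z * (v3 i)%:Z ^+ 2 + (a1%:Z + a2%:Z + a3%:Z) * (v0 i)%:Z ^+ 2
    - 2 * (v0 i)%:Z * (a1%:Z * (v1 i)%:Z + a2%:Z * (v2 i)%:Z + a3%:Z * (v3 i)%:Z)).
    by ring.
  by rewrite L; ring.
have : \sum_i t i = 0.
  under eq_bigr do rewrite tE.
  rewrite sumrB !big_split /= -!mulr_sumr !toZ //.
  by ring.
move/eqP; rewrite psumr_eq0 => [/allP/= all0 i|i _]; last exact: t0.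
have /eqP ti := all0 i (mem_index_enum _).
have : a1%:Z * ((v1 i)%:Z - (v0 i)%:Z) ^+ 2 = 0.
  apply/eqP; rewrite eq_le nn andbT -ti /t -addrA lerDl.
  by rewrite addr_ge0.
move/eqP; rewrite mulf_eq0 expf_eq0 /= subr_eq0 => /orP[/eqP []|/eqP[]//].
by move=> a1E; rewrite a1E in a10.
Qed.

(** Digits below [K] in base [a K] do not carry in a combination of total weight [a], so the
    relation holds digit by digit and the sphere lemma applies. The sphere is the most popular of at
    most [D K^2] squared norms. *)
Lemma behrend (a K D : nat) : (0 < a)%N -> (0 < K)%N -> (0 < D)%N ->
  exists S : {set 'I_((a * K) ^ D)},
    (K ^ D <= D * K ^ 2 * #|S|)%N /\
    forall (a1 a2 a3 : nat) (b0 b1 b2 b3 : 'I_((a * K) ^ D)),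
      (a1 + a2 + a3 = a)%N -> (0 < a1)%N ->
      b0 \in S -> b1 \in S -> b2 \in S -> b3 \in S ->
      (a1 * b1 + a2 * b2 + a3 * b3 = a * b0)%N -> b1 = b0.
Proof.
move=> a0 K0 D0.
pose sq (v : {ffun 'I_D -> 'I_K}) := (\sum_i (v i : nat) ^ 2)%N.
have sq_lt v : (sq v < D * K ^ 2)%N.
  apply: leq_ltn_trans (_ : \sum_(i < D) K.-1 ^ 2 < _)%N.
    apply: leq_sum => i _; rewrite leq_sqr -ltnS prednK //.
  by rewrite sum_nat_const card_ord ltn_mul2l D0 ltn_sqr ltn_predL.
have [rho Hrho] := pigeonhole_fiber (leq_ltn_trans (leq0n _) (sq_lt [ffun=> Ordinal K0])) sq_lt.
have lt_aK (v : {ffun 'I_D -> 'I_K}) i : (v i < a * K)%N.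
  by apply: leq_trans (ltn_ord _) _; rewrite leq_pmull.
pose code (v : {ffun 'I_D -> 'I_K}) : 'I_((a * K) ^ D) :=
  Ordinal (digits_value_lt (lt_aK v)).
have code_inj : injective code.
  move=> v v' /(congr1 (@nat_of_ord _)) /= E; apply/ffunP => i; apply: val_inj.
  exact: (digits_value_inj (lt_aK v) (lt_aK v') E).
exists (code @: [set v | sq v == rho]); split.
  by rewrite card_imset //; move: Hrho; rewrite card_ffun !card_ord.
move=> a1 a2 a3 b0 b1 b2 b3 aE a10 /imsetP[v0 + ->] /imsetP[v1 + ->]
  /imsetP[v2 + ->] /imsetP[v3 + ->]; rewrite !inE.
move=> /eqP n0 /eqP n1 /eqP n2 /eqP n3 lin; congr code.
apply/ffunP => i; apply: val_inj.
pose c (v : {ffun 'I_D -> 'I_K}) j : nat := v j.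
apply: (@sphere_strictly_convex D a1 a2 a3 rho (c v0) (c v1) (c v2) (c v3)) => //.
rewrite aE; apply: (@digits_value_inj (a * K)).
- move=> j; apply: leq_ltn_trans (_ : a * K.-1 < _)%N.
    have le (v : {ffun 'I_D -> 'I_K}) : (v j <= K.-1)%N by rewrite -ltnS prednK.
    by rewrite -aE !mulnDl !leq_add // leq_mul2l le orbT.
  by rewrite ltn_mul2l a0 ltn_predL.
- by move=> j; rewrite ltn_mul2l a0 /= /c.
- have mulE n (v : {ffun 'I_D -> 'I_K}) :
     (n * code v = \sum_(i < D) n * v i * (a * K) ^ i)%N.
    by rewrite /= /digits_value big_distrr /=; apply: eq_bigr => j _; rewrite mulnA.
  move: lin; rewrite !mulE -!big_split /= => lin.
  rewrite /digits_value -lin; apply: eq_bigr => j _.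
  by rewrite !mulnDl.
Qed.

Lemma eq_natr_Fp (p m n : nat) : prime p -> (m < p)%N -> (n < p)%N ->
  m%:R = n%:R :> 'F_p -> m = n.
Proof.
move=> pp mp np /(congr1 (fun x : 'F_p => x : nat)).
by rewrite /= !val_Fp_nat // !modn_small.
Qed.

(* The block width [2 * a * w] exceeds every carry produced by the offsets below [w], so
   a relation between residues descends to the block indices, which form a Behrend set. *)
Lemma block_set (a K D p w : nat) :
  (0 < a)%N -> (0 < K)%N -> (0 < D)%N -> prime p ->
  (4 * a ^ 2 * (a * K) ^ D * w <= p)%N ->
  exists B : {set 'F_p}, (K ^ D * w <= D * K ^ 2 * #|B|)%N /\
    forall (a1 a2 a3 : nat) (r0 r1 r2 r3 f f' : 'F_p),
      (a1 + a2 + a3 = a)%N -> (0 < a1)%N ->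
      r0 \in B -> r1 \in B -> r2 \in B -> r3 \in B ->
      (f < w)%N -> (f' < w)%N ->
      a1%:R * r1 + a2%:R * r2 + a3%:R * r3 + a%:R * f =
      a%:R * r0 + a%:R * f' ->
      ((r1 - r0 + w%:R)%R < 2 * w)%N.
Proof.
move=> a0 K0 D0 pp; set M := ((a * K) ^ D)%N => wp.
have [S [cS HS]] := behrend a0 K0 D0; rewrite -/M in S cS HS.
have M0 : (0 < M)%N by rewrite expn_gt0 muln_gt0 a0 K0.
pose val_of (be : 'I_M * 'I_w) := (2 * a * w * be.1 + be.2)%N.
pose g be : 'F_p := (val_of be)%:R.
(* This leaves room for a combination of total weight [a] together with its offset, so that
   relations modulo [p] become relations between natural numbers. *)
have vB be : (a * val_of be + a * w < p)%N.
  rewrite /val_of; case: be => b e /=; have bM := ltn_ord b; have ew := ltn_ord e.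
  apply: leq_trans wp.
  have h1 : (b.+1 * (2 * a ^ 2 * w) <= M * (2 * a ^ 2 * w))%N by rewrite leq_mul2r bM orbT.
  have h2 : (a * 1 <= a * a)%N by rewrite leq_mul2l a0 orbT.
  have h3 : (a * w <= a * a * w)%N by rewrite leq_mul2r -{1}(muln1 a) h2 orbT.
  have h4 : (1 * (2 * a ^ 2 * w) <= M * (2 * a ^ 2 * w))%N by rewrite leq_mul2r M0 orbT.
  have h5 : (a * e < a * w)%N by rewrite ltn_mul2l a0.
  nia.
have vp be : (val_of be < p)%N.
  apply: leq_ltn_trans (vB be); apply: leq_trans (leq_addr _ _).
  by rewrite leq_pmull.
have vblock be : (val_of be %/ (2 * a * w) = be.1)%N.
  rewrite /val_of; case: be => b e /=; have ew := ltn_ord e.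
  have w0 : (0 < w)%N by apply: leq_ltn_trans ew.
  rewrite mulnC divnMDl ?muln_gt0 ?a0 ?w0 // divn_small ?addn0 //.
  by apply: leq_trans ew _; rewrite leq_pmull // muln_gt0 a0.
have vinj : injective val_of.
  move=> be be' E; have := vblock be; rewrite E vblock => E1.
  move: E; rewrite /val_of E1 => /addnI E2.
  by case: be be' E1 E2 => [b e] [b' e'] /= /val_inj -> /val_inj ->.
have ginj : injective g by move=> be be' /(eq_natr_Fp pp (vp _) (vp _)) /vinj.
exists (g @: [set be | be.1 \in S]); split.
  rewrite card_imset //.
  have -> : [set be : 'I_M * 'I_w | be.1 \in S] = finset.setX S [set: 'I_w].
    by apply/setP => be; rewrite !inE andbT.
  by rewrite cardsX cardsT card_ord mulnA leq_mul2r cS orbT.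
move=> a1 a2 a3 r0 r1 r2 r3 f f' aE a10 /imsetP[be0 + ->] /imsetP[be1 + ->]
  /imsetP[be2 + ->] /imsetP[be3 + ->]; rewrite !inE => S0 S1 S2 S3 fw f'w.
rewrite -[f]natr_Fp_val -[f']natr_Fp_val -!natrM -!natrD.
have mono n x y : (x < y)%N -> (n * x <= n * y)%N by move=> xy; rewrite leq_mul2l ltnW ?orbT.
have bnd : (a1 * val_of be1 + a2 * val_of be2 + a3 * val_of be3 + a * f < p)%N.
  have h : (a * maxn (val_of be1) (maxn (val_of be2) (val_of be3)) + a * w < p)%N.
    case: (leqP (val_of be1) (maxn (val_of be2) (val_of be3))) => _; last exact: vB.
    by case: (leqP (val_of be2) (val_of be3)).
  apply: leq_ltn_trans h; apply: leq_add; last exact: mono.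
  by rewrite -aE !mulnDl !leq_add // leq_mul2l leq_max ?leq_max ?leqnn ?orbT.
have bnd' : (a * val_of be0 + a * f' < p)%N.
  by apply: leq_ltn_trans (vB be0); rewrite leq_add2l mono.
move=> /(eq_natr_Fp pp bnd bnd') E.
(* Division by the block width [2 a w] discards the offsets, whose total on either side is below
   that width. *)
have E1 : be1.1 = be0.1.
  apply: (HS a1 a2 a3 be0.1 be1.1 be2.1 be3.1) => //.
  move: E; rewrite /val_of.
  have := ltn_ord be0.2; have := ltn_ord be1.2; have := ltn_ord be2.2.
  have := ltn_ord be3.2; move=> e3 e2 e1 e0 E.
  have w0 : (0 < w)%N by apply: leq_ltn_trans fw.
  have := congr1 (divn^~ (2 * a * w)) E.
  have -> : (a1 * (2 * a * w * be1.1 + be1.2) + a2 * (2 * a * w * be2.1 + be2.2) +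
     a3 * (2 * a * w * be3.1 + be3.2) + a * f =
     (a1 * be1.1 + a2 * be2.1 + a3 * be3.1) * (2 * a * w) +
     (a1 * be1.2 + a2 * be2.2 + a3 * be3.2 + a * f))%N by ring.
  have -> : (a * (2 * a * w * be0.1 + be0.2) + a * f' =
     (a * be0.1) * (2 * a * w) + (a * be0.2 + a * f'))%N by ring.
  have aw f1 : (f1 < w)%N -> (a * f1 < a * w)%N by move=> ?; rewrite ltn_mul2l a0.
  have s0 : (a * be0.2 + a * f' < 2 * a * w)%N.
    by have := aw _ e0; have := aw _ f'w; rewrite -mulnA; lia.
  have s1 : (a1 * be1.2 + a2 * be2.2 + a3 * be3.2 + a * f < 2 * a * w)%N.
    have := aw _ fw.
    have : (a1 * be1.2 + a2 * be2.2 + a3 * be3.2 <= a * w)%N.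
      by rewrite -aE !mulnDl !leq_add // mono.
    by rewrite -mulnA; lia.
  by rewrite /= !divnMDl ?muln_gt0 ?a0 ?w0 // !divn_small ?addn0.
have e0 := ltn_ord be0.2; have e1 := ltn_ord be1.2.
(* Inside one block [r1 - r0] is a difference of two numbers below [w]; adding [w] gives a residue
   below [2 w]. *)
have -> : g be1 - g be0 + w%:R = (be1.2 + w - be0.2)%N%:R.
  rewrite /g /val_of E1 natrB ?natrD; last by lia.
  by ring.
rewrite val_Fp_nat // modn_small; first by lia.
have : (2 * w <= p)%N.
  apply: leq_trans wp; rewrite leq_mul2r -mulnA; apply/orP; right.
  have : (0 < a ^ 2 * M)%N by rewrite muln_gt0 expn_gt0 a0.
  lia.
lia.
Qed.

(** * From prime fields to grids *)

(** Averaging over the shift [c]: each [z] meets the condition for exactly [#|B|] values of [c]. No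
    count of solutions of a polynomial condition is needed to bound the density of the set from
    below. *)
Lemma exists_dense_parameter (T V : finType) (v0 : V) (G : {set T})
    (Phi : T -> V -> V) (B : {set V}) : (forall z, injective (Phi z)) ->
  exists c, (#|G| * #|B| <= #|V| * #|[set z in G | Phi z c \in B]|)%N.
Proof.
move=> Phi_inj.
have E : (\sum_(c : V) #|[set z in G | Phi z c \in B]| = #|G| * #|B|)%N.
  under eq_bigr do rewrite -sum1dep_card big_mkcondr.
  rewrite exchange_big /= -sum_nat_const; apply: eq_bigr => z _.
  rewrite -big_mkcond sum1dep_card -[in RHS](card_preimset B (Phi_inj z)).
  by apply: eq_card => c; rewrite !inE.
pose c := [arg max_(c > v0) #|[set z in G | Phi z c \in B]|]%N.
exists c; rewrite -E -[X in (_ <= X * _)%N]cardsT -sum_nat_const.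
under [X in (_ <= X)%N]eq_bigl do rewrite inE.
by apply: leq_sum => c' _; rewrite /c; case: arg_maxnP => // i _; apply.
Qed.

(** The residues of the grid [[1, p - 1]^2]. *)
Definition unit_square (p : nat) : {set 'F_p * 'F_p} :=
  [set z | (z.1 != 0) && (z.2 != 0)].

Lemma card_unit_square (p : nat) : prime p -> #|unit_square p| = (p.-1 ^ 2)%N.
Proof.
move=> pp; have -> : unit_square p = finset.setX [set~ 0] [set~ 0].
  by apply/setP => z; rewrite !inE.
by rewrite cardsX cardsC1 card_Fp.
Qed.

Definition residue (p : nat) (x : 'rV[int]_2) : 'F_p * 'F_p :=
  ((x 0 0)%:~R, (x 0 1)%:~R).

Lemma forall_ord2 (Pr : 'I_2 -> Prop) : Pr 0 -> Pr 1 -> forall i, Pr i.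
Proof.
move=> H0 H1 i; case: (unliftP 0 i) => [j ->|-> //].
by rewrite (ord1 j) (_ : lift 0 0 = 1) //; apply: val_inj.
Qed.

Lemma rV2P (T : Type) (x y : 'rV[T]_2) : x 0 0 = y 0 0 -> x 0 1 = y 0 1 -> x = y.
Proof. by move=> E0 E1; apply/rowP; apply: forall_ord2. Qed.

Lemma intr_Fp_eq0 (p : nat) (k : int) : prime p ->
  (k%:~R == 0 :> 'F_p) = (p %| `|k|)%N.
Proof.
move=> pp; case: (intP k) => [|n|n] /=.
- by rewrite mulr0z eqxx dvdn0.
- by rewrite -natr_Fp_eq0.
- by rewrite mulrNz oppr_eq0 -natr_Fp_eq0 // abszN.
Qed.

Lemma intr_Fp_inj (p : nat) (x y : int) : prime p ->
  1 <= x <= p.-1%:Z -> 1 <= y <= p.-1%:Z -> x%:~R = y%:~R :> 'F_p -> x = y.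
Proof.
move=> pp hx hy /eqP; rewrite -subr_eq0 -rmorphB /= intr_Fp_eq0 //.
have := prime_gt1 pp => p1.
have [|k0] := eqVneq `|x - y|%N 0%N; first by lia.
by rewrite gtnNdvd //; lia.
Qed.

Definition lift_point (p : nat) (z : 'F_p * 'F_p) : 'rV[int]_2 :=
  \row_i (if i == 0 then (z.1 : nat)%:Z else (z.2 : nat)%:Z).

Lemma residue_lift (p : nat) (z : 'F_p * 'F_p) : residue p (lift_point z) = z.
Proof. by rewrite /residue !mxE /= -!pmulrn !natr_Fp_val; case: z. Qed.

Lemma lift_point_bounds (p : nat) (z : 'F_p * 'F_p) i : prime p ->
  z \in unit_square p -> 1 <= lift_point z 0 i <= p.-1%:Z.
Proof.
move=> pp; rewrite inE mxE => /andP[].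
have b (x : 'F_p) : x != 0 -> 1 <= (x : nat)%:Z <= p.-1%:Z.
  move=> x0; have := val_Fp_lt x pp; have : (x : nat) != 0%N by [].
  by lia.
by case: ifP => _ /b + /b.
Qed.

(** Here [N = p - 1], and the set in the grid lifts [T]. Points of the grid are determined by their
    residues, so the translates inject into [Z], and a dilation divisible by [p] has none since it
    would identify the images of [y1] and [y2]. *)
Lemma pdd_le (R : realType) (P : {fset 'rV[int]_2}) (y1 y2 : 'rV[int]_2)
    (alpha beta : R) :
  y1 \in P -> y2 \in P -> y1 != y2 -> 0 <= beta ->
  (forall n, exists p, [/\ prime p, (n < p)%N &
    exists T : {set 'F_p * 'F_p},
      alpha * p.-1%:R ^+ 2 <= #|T :&: unit_square p|%:R /\
      forall (d : 'F_p) (Z : {set 'F_p * 'F_p}), d != 0 ->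
        (forall z y, z \in Z -> y \in P ->
          (z.1 + d * (residue p y).1, z.2 + d * (residue p y).2) \in T) ->
        #|Z|%:R <= beta * p.-1%:R ^+ 2]) ->
  pdd P alpha <= beta.
Proof.
move=> y1P y2P y12 b0 H; apply: ge_sup.
  exists 0 => e e0; exists 0%N => N _ A _ _; exists 1 => //.
  by rewrite sub0r mulNr (@le_trans _ _ 0) // oppr_le0 mulr_ge0 ?exprn_ge0 // ltW.
move=> b gb; apply/ler_addgt0Pr => e e0.
have [N0 HN0] := gb _ e0; have [p [pp pN0 [T [Ta Tb]]]] := H N0.
have p1 := prime_gt1 pp.
have Ngt0 : 0 < (p.-1%:R : R) ^+ 2 by rewrite exprn_gt0 // ltr0n; lia.
rewrite -lerBlDr -(ler_pM2r Ngt0).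
pose A : {fset 'rV[int]_2} := [fset lift_point z | z in (T :&: unit_square p)]%fset.
have AP x : x \in A -> exists2 z, z \in T :&: unit_square p & x = lift_point z.
  by case/imfsetP => z /= zT ->; exists z.
have Ab x i : x \in A -> 1 <= x 0 i <= p.-1%:Z.
  by move=> /AP[z /setIP[_ zU] ->]; exact: lift_point_bounds.
have AT x : x \in A -> residue p x \in T.
  by move=> /AP[z /setIP[zT _] ->]; rewrite residue_lift.
have N0p : (N0 <= p.-1)%N by lia.
have [||d d0] := HN0 _ N0p A.
- by move=> x xA i; exact: Ab.
- rewrite card_imfset /=; first by rewrite -cardE.
  exact: can_inj (@residue_lift p).
move=> /le_trans; apply.
set X := fset_set _.
have P0 : P != fset0 by apply/fset0Pn; exists y1.
have XP x y : x \in X -> y \in P -> x + d *: y \in A.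
  rewrite /X in_fset_set ?inE; last exact: finite_dilate_translates.
  by apply.
have [d0p|d0p] := eqVneq (d%:~R : 'F_p) 0.
  suff -> : X = fset0 by rewrite cardfs0 mulr_ge0 // ltW.
  apply/fsetP => x; rewrite inE; apply/negP => xX.
  move/eqP: y12; apply.
  have E i : y1 0 i = y2 0 i.
    have := Ab _ i (XP _ _ xX y1P); have := Ab _ i (XP _ _ xX y2P).
    move=> h2 h1; have := @intr_Fp_inj p _ _ pp h1 h2.
    rewrite !mxE !(rmorphD, rmorphM) /= !d0p !mul0r => /(_ erefl).
    by move/addrI/mulfI; apply.
  by apply: rV2P; exact: E.
pose Z := [set z in [seq residue p x | x <- X]].
have cZ : #|Z| = #|` X|.
  rewrite cardsE; have /card_uniqP -> : uniq [seq residue p x | x <- X].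
    rewrite map_inj_in_uniq ?fset_uniq // => x x' xX x'X [E0 E1].
    have E i : x 0 i = x' 0 i.
      have xi : (x 0 i)%:~R = (x' 0 i)%:~R :> 'F_p by move: i; exact: forall_ord2.
      have := Ab _ i (XP _ _ xX y1P); have := Ab _ i (XP _ _ x'X y1P).
      move=> h2 h1; have := @intr_Fp_inj p _ _ pp h1 h2.
      by rewrite !mxE !rmorphD /= xi => /(_ erefl) /addIr.
    by apply: rV2P; exact: E.
  by rewrite size_map.
rewrite -cZ; apply: (Tb d%:~R) => // z y; rewrite inE => /mapP[x xX ->] yP.
have := AT _ (XP _ _ xX yP).
by rewrite /residue !mxE !(rmorphD, rmorphM).
Qed.

(** * Point sets with a convex dependence *)

(* With [E] and [G] the second moments below, [G x^2 - E y^2] balances; it degenerates only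
   when [E = 0] or [G = 0], and then [x y] balances. *)
Lemma balanced_quadratic_form (a1 a2 a3 : nat) (x1 y1 x2 y2 x3 y3 : int) :
  (0 < a1)%N -> (x1, y1) != (0, 0) ->
  exists A B C : int,
    a1%:Z * (A * x1 ^+ 2 + B * x1 * y1 + C * y1 ^+ 2) +
    a2%:Z * (A * x2 ^+ 2 + B * x2 * y2 + C * y2 ^+ 2) +
    a3%:Z * (A * x3 ^+ 2 + B * x3 * y3 + C * y3 ^+ 2) = 0 /\
    (2 * A * x1 + B * y1, B * x1 + 2 * C * y1) != (0, 0).
Proof.
move=> a10 xy1.
pose E := a1%:Z * x1 ^+ 2 + a2%:Z * x2 ^+ 2 + a3%:Z * x3 ^+ 2.
pose G := a1%:Z * y1 ^+ 2 + a2%:Z * y2 ^+ 2 + a3%:Z * y3 ^+ 2.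
have z0 (s1 s2 s3 : int) : a1%:Z * s1 ^+ 2 + a2%:Z * s2 ^+ 2 + a3%:Z * s3 ^+ 2 = 0 ->
    [/\ a1%:Z * s1 = 0, a2%:Z * s2 = 0 & a3%:Z * s3 = 0].
  have red (b : nat) (s : int) : b%:Z * s ^+ 2 == 0 -> b%:Z * s = 0.
    by rewrite mulf_eq0 sqrf_eq0 -mulf_eq0 => /eqP.
  have nn (b : nat) (s : int) : 0 <= b%:Z * s ^+ 2 by rewrite mulr_ge0 ?sqr_ge0.
  move=> /eqP; rewrite !paddr_eq0 ?addr_ge0 ?nn //.
  by move=> /andP[/andP[/red -> /red ->] /red ->].
have [E0|E0] := eqVneq E 0.
  exists 0; exists 1; exists 0; have [h1 h2 h3] := z0 _ _ _ E0; split.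
    rewrite !mul0r !addr0 !add0r !mul1r !mulrA h1 h2 h3; ring.
  move/eqP: h1; rewrite mulf_eq0 => /orP[/eqP[h]|/eqP h1]; first by rewrite h in a10.
  by move: xy1; rewrite h1 !xpair_eqE eqxx /= !mulr0 mul0r mul1r add0r addr0 eqxx andbT.
have [G0|G0] := eqVneq G 0.
  exists 0; exists 1; exists 0; have [h1 h2 h3] := z0 _ _ _ G0; split.
    transitivity (x1 * (a1%:Z * y1) + x2 * (a2%:Z * y2) + x3 * (a3%:Z * y3)); first by ring.
    by rewrite h1 h2 h3; ring.
  move/eqP: h1; rewrite mulf_eq0 => /orP[/eqP[h]|/eqP h1]; first by rewrite h in a10.
  by move: xy1; rewrite h1 !xpair_eqE eqxx /= !mulr0 !mul0r mul1r add0r addr0 eqxx andbT.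
exists G; exists 0; exists (- E); split; first by rewrite /E /G; ring.
apply: contraNneq xy1 => -[/eqP + /eqP].
rewrite mul0r addr0 mul0r add0r !mulf_eq0 oppr_eq0 (negPf G0) (negPf E0) /=.
by move=> /eqP -> /eqP ->.
Qed.

(** Taylor expansion around the point with index 0: the linear terms cancel by the dependence of the
    points, the quadratic ones by the balance of [q]. *)
Lemma quadratic_relation (F : comNzRingType)
    (A B C c a1 a2 a3 d s t x0 y0 x1 y1 x2 y2 x3 y3 : F) :
  let q x y := A * x ^+ 2 + B * x * y + C * y ^+ 2 in
  a1 * (x1 - x0) + a2 * (x2 - x0) + a3 * (x3 - x0) = 0 ->
  a1 * (y1 - y0) + a2 * (y2 - y0) + a3 * (y3 - y0) = 0 ->
  a1 * q (x1 - x0) (y1 - y0) + a2 * q (x2 - x0) (y2 - y0) +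
    a3 * q (x3 - x0) (y3 - y0) = 0 ->
  a1 * (q (s + d * x1) (t + d * y1) + c) + a2 * (q (s + d * x2) (t + d * y2) + c) +
    a3 * (q (s + d * x3) (t + d * y3) + c) =
  (a1 + a2 + a3) * (q (s + d * x0) (t + d * y0) + c).
Proof.
move=> q hx hy hq; apply/eqP; rewrite -subr_eq0; apply/eqP.
transitivity (d * (2 * A * (s + d * x0) + B * (t + d * y0)) *
    (a1 * (x1 - x0) + a2 * (x2 - x0) + a3 * (x3 - x0)) +
  d * (B * (s + d * x0) + 2 * C * (t + d * y0)) *
    (a1 * (y1 - y0) + a2 * (y2 - y0) + a3 * (y3 - y0)) +
  d ^+ 2 * (a1 * q (x1 - x0) (y1 - y0) + a2 * q (x2 - x0) (y2 - y0) +
    a3 * q (x3 - x0) (y3 - y0))); first by rewrite /q; ring.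
by rewrite hx hy hq; ring.
Qed.

Lemma card_linear_strip (p w : nat) (e1 e2 c : 'F_p) (Z : {set 'F_p * 'F_p}) :
  prime p -> (w <= p)%N -> (e1, e2) != (0, 0) ->
  (forall z, z \in Z -> (e1 * z.1 + e2 * z.2 + c)%R < w)%N ->
  (#|Z| <= p * w)%N.
Proof.
move=> pp wp e0 HZ.
(* One coordinate with nonzero coefficient is traded for the value of the affine form. *)
pose f (z : 'F_p * 'F_p) :=
  (if e2 == 0 then z.2 else z.1, e1 * z.1 + e2 * z.2 + c).
have finj : injective f.
  move=> [s t] [s' t'] /eqP; rewrite /f xpair_eqE /= (inj_eq (addIr _)).
  have [e20|e20] := eqVneq e2 0 => /andP[/eqP ->].
    rewrite (inj_eq (addIr _)) (inj_eq (mulfI _)); first by move/eqP ->.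
    by move: e0; rewrite e20 xpair_eqE eqxx andbT.
  by rewrite (inj_eq (addrI _)) (inj_eq (mulfI _)) // => /eqP ->.
rewrite -(card_imset _ finj).
have -> : (p * w = #|finset.setX [set: 'F_p] [set x : 'F_p | (x < w)%N]|)%N.
  by rewrite cardsX cardsT card_Fp // card_Fp_lt.
apply: subset_leq_card; apply/fintype.subsetP => _ /imsetP[z zZ ->].
by rewrite !inE /=; exact: HZ.
Qed.

Lemma expn_ge_id2 D : (D <= 2 ^ D)%N.
Proof. exact: ltnW (ltn_expl D (ltnSn 1)). Qed.

Lemma expn8_2 D : (8 ^ D = 2 ^ D * (2 ^ D) ^ 2)%N.
Proof. by rewrite -expnM -expnD (_ : 8 = 2 ^ 3)%N // -expnM; congr expn; lia. Qed.

Lemma dvdn_absz_eq0 (p : nat) (e : int) :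
  (`|e| < p)%N -> (p %| `|e|)%N -> e = 0.
Proof.
move=> ep; have [/eqP|k0] := eqVneq `|e|%N 0%N; first by rewrite absz_eq0 => /eqP.
by rewrite gtnNdvd // lt0n.
Qed.

Lemma exists_large_prime (n : nat) : exists2 p, prime p & (n < p)%N.
Proof. by have [p np pp] := prime_above n; exists p. Qed.

Lemma exists_prime_gt_all (s : seq nat) : exists2 p, prime p & all (ltn^~ p) s.
Proof.
have [p pp hp] := exists_large_prime (\max_(i <- s) i); exists p => //.
by apply/allP => i hi; apply: leq_ltn_trans hp; exact: leq_bigmax_seq.
Qed.

(** With [K = 2^D] the Behrend condition costs a factor exponential in [D], while confinement to an
    interval of length [2 w] saves [2^(D^2)] up to a constant: [w] is at most [p / (4 a^2 M)] and
    [M >= 2^(D^2)]. *)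
Lemma pdd_nonconvex_le (R : realType) (P : {fset 'rV[int]_2})
    (p0 p1 p2 p3 : 'rV[int]_2) (a1 a2 a3 D : nat) (alpha : R) :
  p0 \in P -> p1 \in P -> p2 \in P -> p3 \in P -> p1 != p0 ->
  (0 < a1)%N -> (0 < D)%N ->
  (forall i, a1%:Z * (p1 0 i - p0 0 i) + a2%:Z * (p2 0 i - p0 0 i) +
             a3%:Z * (p3 0 i - p0 0 i) = 0) ->
  alpha <= ((64 * (a1 + a2 + a3) ^ 3) ^ D)%:R^-1 ->
  pdd P alpha <= 2 / (2 ^ (D ^ 2))%:R.
Proof.
move=> P0 P1 P2 P3 p10 a10 D0 rel.
set a := (a1 + a2 + a3)%N => ha.
have a0 : (0 < a)%N by rewrite /a; lia.
have u0 : (p1 0 0 - p0 0 0, p1 0 1 - p0 0 1) != (0, 0).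
  apply: contraNneq p10 => -[/eqP + /eqP]; rewrite !subr_eq0 => /eqP E0 /eqP E1.
  by apply/eqP; apply: rV2P.
have [qA [qB [qC [qrel qnz]]]] := @balanced_quadratic_form a1 a2 a3 _ _
  (p2 0 0 - p0 0 0) (p2 0 1 - p0 0 1) (p3 0 0 - p0 0 0) (p3 0 1 - p0 0 1) a10 u0.
(* The polar form of [q] at [p1 - p0]: [d] times it is the linear part of
   [q (x + d p1) - q (x + d p0)]. *)
set e1 := (X in (X, _) != _) in qnz; set e2 := (X in (_, X) != _) in qnz.
pose K := (2 ^ D)%N; have [M ME] : exists M, M = ((a * K) ^ D)%N by eexists.
have K0 : (0 < K)%N by rewrite expn_gt0.
have M0 : (0 < M)%N by rewrite ME expn_gt0 muln_gt0 a0 K0.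
have aM0 : (0 < 4 * a ^ 2 * M)%N by rewrite muln_gt0 M0 muln_gt0 expn_gt0 a0.
have [X XE] : exists X, X = (4 * a ^ 2 * M)%N by eexists.
rewrite -XE in aM0.
apply: (pdd_le P1 P0 p10); first by rewrite divr_ge0.
move=> n; have [p pp /and5P[np e1p e2p Xp _]] :=
  exists_prime_gt_all [:: n; `|e1|; `|e2|; X]%N.
exists p; split=> //.
pose w := (p %/ X)%N.
have wle : (X * w <= p)%N by rewrite mulnC leq_trunc_div.
have w0 : (0 < w)%N by rewrite divn_gt0 // ltnW.
have wge : (p <= 2 * X * w)%N.
  rewrite {1}(divn_eq p X) -/w -mulnA mul2n -addnn (mulnC X) leq_add2l.
  by rewrite (leq_trans (ltnW (ltn_pmod p aM0))) // leq_pmull.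
have w2 : (2 * w <= p)%N.
  apply: leq_trans wle; rewrite leq_mul2r XE -mulnA; apply/orP; right.
  by rewrite (leq_trans _ (leq_pmulr _ _)) // muln_gt0 expn_gt0 a0.
rewrite XE ME in wle.
have [B [cB HB]] := block_set a0 K0 D0 pp wle.
pose q (z : 'F_p * 'F_p) : 'F_p := qA%:~R * z.1 ^+ 2 + qB%:~R * z.1 * z.2 + qC%:~R * z.2 ^+ 2.
have [c Hc] := @exists_dense_parameter _ _ 0 (unit_square p)
  (fun z c => q z + c) B (fun z => addrI (q z)).
exists [set z | q z + c \in B]; split.
  set t := #|_ :&: _|.
  have Ht : (p.-1 ^ 2 * #|B| <= p * t)%N.
    move: Hc; rewrite card_unit_square // card_Fp // => /leq_trans; apply.
    rewrite leq_mul2l; apply/orP; right; apply: subset_leq_card.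
    by apply/fintype.subsetP => z; rewrite !inE andbC.
  have KM : (M = a ^ D * K ^ D)%N by rewrite ME expnMn.
  have main : (p.-1 ^ 2 <= D * K ^ 2 * (8 * a ^ 2) * a ^ D * t)%N.
    have wK0 : (0 < K ^ D * w)%N by rewrite muln_gt0 expn_gt0 K0 w0.
    rewrite -(leq_pmul2r wK0).
    apply: leq_trans (_ : p.-1 ^ 2 * (D * K ^ 2 * #|B|) <= _)%N.
      by rewrite leq_mul2l cB orbT.
    apply: leq_trans (_ : D * K ^ 2 * (p * t) <= _)%N.
      by rewrite mulnCA leq_mul2l Ht orbT.
    apply: leq_trans (_ : D * K ^ 2 * (2 * X * w * t) <= _)%N.
      by rewrite leq_mul2l leq_mul2r wge !orbT.
    by rewrite XE KM leq_eqVlt; apply/orP; left; apply/eqP; ring.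
  (* From [D K^2 <= 8^D] and [8 a^2 <= (8 a^2)^D]. *)
  have main2 : (p.-1 ^ 2 <= (64 * a ^ 3) ^ D * t)%N.
    apply: leq_trans main _; rewrite leq_mul2r; apply/orP; right.
    have -> : (64 * a ^ 3 = 8 * (8 * a ^ 2) * a)%N by ring.
    rewrite (expnMn _ a) (expnMn 8) leq_mul2r; apply/orP; right.
    apply: leq_mul.
      by rewrite expn8_2 leq_mul2r expn_ge_id2 orbT.
    have : (0 < 8 * a ^ 2)%N by rewrite muln_gt0 expn_gt0 a0.
    by move: (8 * a ^ 2)%N => c8 c80; rewrite -{1}[c8]expn1 leq_pexp2l.
  have h64 : (0 : R) < ((64 * a ^ 3) ^ D)%:R.
    by rewrite ltr0n expn_gt0 muln_gt0 expn_gt0 a0.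
  apply: le_trans (ler_wpM2r _ ha) _; first by rewrite exprn_ge0.
  by rewrite mulrC ler_pdivrMr // -natrX -natrM ler_nat mulnC.
move=> d Z d0 HZ.
have bound : (#|Z| <= p * (2 * w))%N.
  set x0 := (residue p p0).1; set y0 := (residue p p0).2.
  pose E1 : 'F_p := d * e1%:~R; pose E2 : 'F_p := d * e2%:~R.
  pose C0 : 'F_p := d ^+ 2 * (e1%:~R * x0 + e2%:~R * y0 + q (residue p (p1 - p0))) + w%:R.
  apply: (@card_linear_strip p (2 * w) E1 E2 C0) => //.
  - apply: contra qnz; rewrite xpair_eqE /E1 /E2 !mulf_eq0 (negPf d0) /=.
    rewrite !intr_Fp_eq0 // => /andP[h1 h2].
    by rewrite xpair_eqE (dvdn_absz_eq0 e1p h1) (dvdn_absz_eq0 e2p h2) eqxx.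
  move=> z zZ.
  pose r y := q (z.1 + d * (residue p y).1, z.2 + d * (residue p y).2) + c.
  have rB y : y \in P -> r y \in B by move=> /(HZ _ _ zZ); rewrite inE.
  (* The relation is exact here, so both offsets are 0. *)
  have := HB a1 a2 a3 (r p0) (r p1) (r p2) (r p3) 0 0 erefl a10
    (rB _ P0) (rB _ P1) (rB _ P2) (rB _ P3) w0 w0.
  have toF (i : 'I_2) := congr1 (fun k : int => k%:~R : 'F_p) (rel i).
  have relx := toF 0; have rely := toF 1; clear toF.
  have qrelF := congr1 (fun k : int => k%:~R : 'F_p) qrel.
  rewrite /= !(rmorphD, rmorphM, rmorphB, rmorphXn, rmorphN) /= in relx rely qrelF.
  have -> : r p1 - r p0 + w%:R = E1 * z.1 + E2 * z.2 + C0.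
    rewrite /r /E1 /E2 /C0 /q /x0 /y0 /e1 /e2 /residue /= !mxE.
    rewrite !(rmorphD, rmorphM, rmorphB, rmorphXn, rmorphN) /=.
    ring.
  apply; rewrite !mulr0 !addr0 /a !natrD.
  exact: quadratic_relation.
rewrite -natrX -mulrAC ler_pdivlMr ?ltr0n ?expn_gt0 // -!natrM ler_nat.
apply: leq_trans (_ : p * (2 * w) * M <= _)%N.
  apply: leq_mul => //; rewrite ME expnMn /K -expnM -mulnn leq_pmull //.
  by rewrite expn_gt0 a0.
have h1 : (4 * (M * w) <= p)%N.
  apply: leq_trans wle; rewrite -ME mulnA leq_mul2r leq_mul2r.
  by rewrite (leq_pmulr 4) ?orbT // expn_gt0 a0.
have h2 : (2 * (p * (2 * w) * M) <= p * p)%N.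
  by rewrite (_ : 2 * (p * (2 * w) * M) = p * (4 * (M * w)))%N ?leq_mul2l ?h1 ?orbT //; ring.
have h3 : (p * p <= 4 * p.-1 ^ 2)%N.
  have p_gt1 := prime_gt1 pp.
  have h : (p <= 2 * p.-1)%N by clear -p_gt1; lia.
  by apply: leq_trans (leq_mul h h) _; rewrite leq_eqVlt; apply/orP; left; apply/eqP; ring.
by rewrite -(leq_pmul2l (isT : 0 < 2)%N) (leq_trans h2) // mulnA.
Qed.

(** * Point sets in general position *)

(* The exponents 7, 4, 2 are far enough apart for the top coefficients of the three families
   to be read off separately. *)
Lemma triforce_polys_independent (F : fieldType) (lw lh lu : F)
    (w1 w2 w4 h1 h3 h4 u1 u2 u4 c c' : F) (k0 k1 k2 k3 k4 : F) :
  let W b := (lw *: 'X + b%:P) ^+ 7 in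
  let H b := (lh *: 'X + b%:P) ^+ 4 in
  let U b := (lu *: 'X + b%:P) ^+ 2 in
  let Q := k0 *: (H h1 + U u1 + W w1 + c%:P) + (k1 *: (H h1 + U u2 + W w2 + c%:P) +
    (k2 *: (H h3 + U u2 + W w1 + c%:P) + (k3 *: (H h4 + U u4 + W w4 + c%:P) +
    k4 *: (U u2 - U u1 + c'%:P)))) in
  lw != 0 -> lh != 0 -> lu != 0 ->
  7%:R != 0 :> F -> 3%:R != 0 :> F -> 2%:R != 0 :> F ->
  w1 != w2 -> w1 != w4 -> w2 != w4 -> h1 != h3 -> u1 != u2 ->
  (size Q <= 8)%N /\
  ((size Q <= 1)%N -> [/\ k0 = 0, k1 = 0, k2 = 0, k3 = 0 & k4 = 0]).
Proof.
move=> W H U Q lw0 lh0 lu0 n7 n3 n2 w12 w14 w24 h13 u12.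
have cE (j : nat) : Q`_j.+1 =
    k0 * ((H h1)`_j.+1 + (U u1)`_j.+1 + (W w1)`_j.+1) +
   (k1 * ((H h1)`_j.+1 + (U u2)`_j.+1 + (W w2)`_j.+1) +
   (k2 * ((H h3)`_j.+1 + (U u2)`_j.+1 + (W w1)`_j.+1) +
   (k3 * ((H h4)`_j.+1 + (U u4)`_j.+1 + (W w4)`_j.+1) +
    k4 * ((U u2)`_j.+1 - (U u1)`_j.+1)))).
  by rewrite /Q !(coefD, coefZ, coefN, coefC) !addr0.
have bigH b j : (4 < j)%N -> (H b)`_j = 0.
  by move=> hj; rewrite coef_linear_exp bin_small.
have bigU b j : (2 < j)%N -> (U b)`_j = 0.
  by move=> hj; rewrite coef_linear_exp bin_small.
have bigW b j : (7 < j)%N -> (W b)`_j = 0.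
  by move=> hj; rewrite coef_linear_exp bin_small.
split.
  apply/leq_sizeP => -[//|j] hj.
  have [j4 j2] : (4 < j.+1)%N /\ (2 < j.+1)%N by split; apply: leq_trans hj.
  by rewrite cE !(bigH _ _ j4) !(bigU _ _ j2) !(bigW _ _ hj); ring.
move=> /leq_sizeP sQ.
have e7 := cE 6%N; have e6 := cE 5%N; have e5 := cE 4%N.
have e3 := cE 2%N; have e1 := cE 0%N.
rewrite sQ // !bigH // !bigU // !coef_linear_exp (_ : 'C(7, 7) = 1%N) // in e7.
rewrite sQ // !bigH // !bigU // !coef_linear_exp (_ : 'C(7, 6) = 7%N) // in e6.
rewrite sQ // !bigH // !bigU // !coef_linear_exp (_ : 'C(7, 5) = 21%N) // in e5.
(* Degrees 7, 6 and 5 come from the seventh powers alone: a Vandermonde system in [k0 + k2], [k1],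
   [k3] with nodes [w1], [w2], [w4]. *)
have S0 : k0 + k1 + k2 + k3 = 0.
  apply: (mulfI (expf_neq0 7 lw0)); rewrite mulr0 e7; ring.
have S1 : (k0 + k2) * w1 + k1 * w2 + k3 * w4 = 0.
  apply: (mulfI (expf_neq0 6 lw0)); apply: (mulfI n7); rewrite !mulr0 e6; ring.
have S2 : (k0 + k2) * w1 ^+ 2 + k1 * w2 ^+ 2 + k3 * w4 ^+ 2 = 0.
  apply: (mulfI (expf_neq0 5 lw0)); apply: (mulfI n7); apply: (mulfI n3).
  by rewrite !mulr0 e5; ring.
have k10 : k1 = 0.
  have : k1 * ((w1 - w2) * (w2 - w4)) = 0.
    transitivity (- ((k0 + k2) * w1 ^+ 2 + k1 * w2 ^+ 2 + k3 * w4 ^+ 2) +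
      (w1 + w4) * ((k0 + k2) * w1 + k1 * w2 + k3 * w4) -
      w1 * w4 * (k0 + k1 + k2 + k3)); first by ring.
    by rewrite S0 S1 S2; ring.
  by move/eqP; rewrite !mulf_eq0 !subr_eq0 (negPf w12) (negPf w24) !orbF => /eqP.
have k30 : k3 = 0.
  have : k3 * ((w1 - w4) * (w2 - w4)) = 0.
    transitivity ((k0 + k2) * w1 ^+ 2 + k1 * w2 ^+ 2 + k3 * w4 ^+ 2 -
      (w1 + w2) * ((k0 + k2) * w1 + k1 * w2 + k3 * w4) +
      w1 * w2 * (k0 + k1 + k2 + k3)); first by ring.
    by rewrite S0 S1 S2; ring.
  by move/eqP; rewrite !mulf_eq0 !subr_eq0 (negPf w14) (negPf w24) !orbF => /eqP.
have k20 : k2 = - k0.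
  by apply/eqP; rewrite -addr_eq0 addrC -S0 k10 k30 !addr0.
(* With [k2 = - k0] the seventh powers cancel, and degree 3 sees only the fourth powers. *)
rewrite sQ // !bigU // !coef_linear_exp k10 k30 k20 in e3.
rewrite (_ : 'C(4, 3) = 4%N) // in e3.
have k00 : k0 = 0.
  have : k0 * (h1 - h3) = 0.
    apply: (mulfI (expf_neq0 3 lh0)); apply: (mulfI n2); apply: (mulfI n2).
    by rewrite !mulr0 e3; ring.
  by move/eqP; rewrite mulf_eq0 subr_eq0 (negPf h13) orbF => /eqP.
rewrite sQ // !coef_linear_exp k10 k30 k20 k00 in e1.
rewrite (_ : 'C(2, 1) = 2%N) // in e1.
have k40 : k4 = 0.
  have : k4 * (u1 - u2) = 0.
    by apply: (mulfI lu0); apply: (mulfI n2); rewrite !mulr0 -[RHS]oppr0 e1; ring.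
  by move/eqP; rewrite mulf_eq0 subr_eq0 (negPf u12) orbF => /eqP.
by rewrite k20 k00 oppr0.
Qed.

(** The direction [(1, m)] is not parallel to [(X, Y)]: [Y = m X] with [X != 0] would force
    [|Y| >= m]. *)
Lemma slope_neq0 (X Y : int) (m : nat) :
  (X, Y) != (0, 0) -> (`|Y| < m)%N -> Y - m%:Z * X != 0.
Proof.
move=> XY Ym; have [X0|X0] := eqVneq X 0.
  by move: XY; rewrite X0 xpair_eqE eqxx mulr0 subr0.
rewrite subr_eq0; apply: contraL Ym => /eqP ->.
by rewrite abszM /= -leqNgt leq_pmulr // absz_gt0.
Qed.

Lemma card_le_by_lines (p q : nat) (mu : 'F_p) (Z : {set 'F_p * 'F_p}) :
  prime p ->
  (forall s, #|[set t | (t, (s + mu * t)%R) \in Z]| * q <= p)%N ->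
  (#|Z| * q <= p * p)%N.
Proof.
move=> pp HZ; rewrite -sum1_card (partition_big (fun z => z.2 - mu * z.1) xpredT) //=.
rewrite big_distrl /=.
apply: leq_trans (_ : \sum_(s : 'F_p) p <= _)%N; last first.
  by rewrite sum_nat_const card_Fp.
apply: leq_sum => s _; apply: leq_trans (HZ s); rewrite leq_mul2r.
apply/orP; right; rewrite sum1dep_card.
apply: leq_trans (leq_imset_card (fun t => (t, s + mu * t)) _).
apply: subset_leq_card; apply/fintype.subsetP => -[x y]; rewrite inE /= => /andP[zZ /eqP E].
have yE : y = s + mu * x by rewrite -E; ring.
by apply/imsetP; exists x; rewrite ?inE -yE.
Qed.

Lemma forall_ord5 (Pr : 'I_5 -> Prop) :
  Pr ord0 -> Pr (lift ord0 ord0) -> Pr (lift ord0 (lift ord0 ord0)) ->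
  Pr (lift ord0 (lift ord0 (lift ord0 ord0))) ->
  Pr (lift ord0 (lift ord0 (lift ord0 (lift ord0 ord0)))) -> forall i, Pr i.
Proof.
move=> H0 H1 H2 H3 H4 i.
by do 4!(case: (unliftP ord0 i) => [{}i ->|->] //); rewrite ord1.
Qed.

(** On a line each linear form becomes affine in [t]. The digit in a constant term names a point of
    [P], with repetitions because each form is constant along a side: [h1] serves [p1] and [p2],
    [u2] serves [p2] and [p3], [w1] serves [p1] and [p3]. As [n0] depends on [N0] only, all lines
    and all [d] are covered. *)
Lemma triforce_lines (N0 : nat) : exists n0 : nat,
  forall (p : nat), prime p -> (n0 <= p)%N ->
  forall (w : nat) (lw lh lu w1 w2 w4 h1 h3 h4 u1 u2 u4 c : 'F_p) (Z : {set 'F_p}),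
  lw != 0 -> lh != 0 -> lu != 0 ->
  w1 != w2 -> w1 != w4 -> w2 != w4 -> h1 != h3 -> u1 != u2 ->
  (4 * w <= p)%N ->
  (forall t, t \in Z ->
     let W b := (lw * t + b) ^+ 7 in
     let H b := (lh * t + b) ^+ 4 in
     let U b := (lu * t + b) ^+ 2 in
     [/\ (H h1 + U u1 + W w1 + c)%R < 2 * w, (H h1 + U u2 + W w2 + c)%R < 2 * w,
         (H h3 + U u2 + W w1 + c)%R < 2 * w, (H h4 + U u4 + W w4 + c)%R < 2 * w &
         (U u2 - U u1 + w%:R)%R < 2 * w]%N) ->
  (N0 * p ^ 5 * (#|Z| * (2 * w) ^ 5) <=
   N0 * ((2 * (2 * w)) ^ 2) ^ 5 * p + (p * (2 * (2 * w))) ^ 5 * p)%N.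
Proof.
have [n0 Hn0] := interval_equidistribution 7 5 N0.
(* The summand 8 makes 2, 3 and 7 invertible modulo [p]. *)
exists (n0 + 8)%N => p pp np w lw lh lu w1 w2 w4 h1 h3 h4 u1 u2 u4 c Z.
move=> lw0 lh0 lu0 w12 w14 w24 h13 u12 wp HZ.
pose W b := (lw *: 'X + b%:P) ^+ 7 : {poly 'F_p}.
pose H b := (lh *: 'X + b%:P) ^+ 4 : {poly 'F_p}.
pose U b := (lu *: 'X + b%:P) ^+ 2 : {poly 'F_p}.
pose G (j : 'I_5) := nth 0 [:: H h1 + U u1 + W w1 + c%:P;
  H h1 + U u2 + W w2 + c%:P; H h3 + U u2 + W w1 + c%:P;
  H h4 + U u4 + W w4 + c%:P; U u2 - U u1 + w%:R%:P] j.
apply: (Hn0 p pp _ G (2 * w)%N Z).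
- exact: leq_trans (leq_addr _ _) np.
- move=> k kN0; rewrite !big_ord_recl big_ord0 addr0.
  have nz m : (0 < m < 8)%N -> m%:R != 0 :> 'F_p.
    move=> /andP[m0 m8]; rewrite natr_Fp_neq0 // m0 /=.
    by apply: leq_trans np; apply: leq_trans m8 _; exact: leq_addl.
  have [s8 s1] := @triforce_polys_independent _ lw lh lu w1 w2 w4 h1 h3 h4 u1 u2 u4
    c w%:R (k ord0) (k (lift ord0 ord0)) (k (lift ord0 (lift ord0 ord0)))
    (k (lift ord0 (lift ord0 (lift ord0 ord0))))
    (k (lift ord0 (lift ord0 (lift ord0 (lift ord0 ord0)))))
    lw0 lh0 lu0 (nz 7%N isT) (nz 3%N isT) (nz 2%N isT) w12 w14 w24 h13 u12.
  rewrite ltnNge; apply/andP; split; last exact: s8.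
  apply: contraNN kN0 => /s1[k0 k1 k2 k3 k4].
  by apply/eqP/ffunP; apply: forall_ord5; rewrite ffunE.
- by rewrite mulnA.
- move=> t j tZ; move: j; have [] := HZ t tZ => g0 g1 g2 g3 g4.
  by apply: forall_ord5; rewrite /G /= /H /U /W !hornerE.
Qed.

(** Main term and error are at most [p / (32 M^5)] each: the first is [p (8 w / p)^5] with
    [16 M w <= p], the second is [2^5 p / (1024 M^5)]. *)
Lemma line_count_arith (p M w z : nat) : (0 < p)%N -> (0 < M)%N -> (0 < w)%N ->
  (16 * M * w <= p)%N ->
  (1024 * M ^ 5 * p ^ 5 * (z * (2 * w) ^ 5) <=
   1024 * M ^ 5 * ((2 * (2 * w)) ^ 2) ^ 5 * p + (p * (2 * (2 * w))) ^ 5 * p)%N ->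
  (z * (16 * M ^ 5) <= p)%N.
Proof.
move=> p0 M0 w0 wp main.
have c0 : (0 < 64 * M ^ 5 * p ^ 5 * (2 * w) ^ 5)%N.
  by rewrite !(expn_gt0, muln_gt0) p0 M0 w0.
rewrite -(leq_pmul2l c0).
have -> : (64 * M ^ 5 * p ^ 5 * (2 * w) ^ 5 * (z * (16 * M ^ 5)) =
  M ^ 5 * (1024 * M ^ 5 * p ^ 5 * (z * (2 * w) ^ 5)))%N by ring.
apply: leq_trans (_ : M ^ 5 * (1024 * M ^ 5 * ((2 * (2 * w)) ^ 2) ^ 5 * p +
  (p * (2 * (2 * w))) ^ 5 * p) <= _)%N; first by rewrite leq_mul2l main orbT.
have -> : (M ^ 5 * (1024 * M ^ 5 * ((2 * (2 * w)) ^ 2) ^ 5 * p + (p * (2 * (2 * w))) ^ 5 * p) =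
   32 * M ^ 5 * (2 * w) ^ 5 * p * ((16 * M * w) ^ 5) +
   32 * M ^ 5 * (2 * w) ^ 5 * p * p ^ 5)%N by ring.
have -> : (64 * M ^ 5 * p ^ 5 * (2 * w) ^ 5 * p =
   32 * M ^ 5 * (2 * w) ^ 5 * p * p ^ 5 + 32 * M ^ 5 * (2 * w) ^ 5 * p * p ^ 5)%N by ring.
by rewrite leq_add2r leq_mul2l leq_exp2r // wp orbT.
Qed.

Definition cross (a b c d : 'rV[int]_2) : int :=
  (a 0 0 - b 0 0) * (c 0 1 - d 0 1) - (a 0 1 - b 0 1) * (c 0 0 - d 0 0).

Lemma cross_neq0_diff (a b c d : 'rV[int]_2) : cross a b c d != 0 ->
  (a 0 0 - b 0 0, a 0 1 - b 0 1) != (0, 0) /\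
  (c 0 0 - d 0 0, c 0 1 - d 0 1) != (0, 0).
Proof.
move=> h; split; apply: contraNneq h => -[h0 h1];
by rewrite /cross h0 h1; apply/eqP; ring.
Qed.

(** Each of the five conditions has probability of order [1 / M], and the density is [1 / M] up to a
    factor exponential in [D]. Since [M = 2^(D^2 + D)], that factor is negligible and the exponent
    tends to 5. *)
Lemma pdd_convex_le (R : realType) (P : {fset 'rV[int]_2})
    (p1 p2 p3 p4 : 'rV[int]_2) (D : nat) (alpha : R) :
  p1 \in P -> p2 \in P -> p3 \in P -> p4 \in P ->
  cross p1 p2 p1 p3 != 0 -> cross p1 p4 p1 p3 != 0 -> cross p2 p4 p1 p3 != 0 ->
  (0 < D)%N ->
  alpha <= (2 ^ (D ^ 2 + 5 * D + 10))%:R^-1 ->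
  pdd P alpha <= (2 ^ (5 * (D ^ 2 + D)))%:R^-1.
Proof.
have lt_sum3 (x y t : nat) :
  [/\ x < (x + y + t).+1, y < (x + y + t).+1 & t < (x + y + t).+1]%N by split; lia.
move=> P1 P2 P3 P4 c123 c143 c243 D0 ha.
have [nz12 nz13] := cross_neq0_diff c123.
have c123' : cross p1 p2 p2 p3 != 0.
  by rewrite (_ : cross p1 p2 p2 p3 = cross p1 p2 p1 p3) // /cross; ring.
have [_ nz23] := cross_neq0_diff c123'.
have p12 : p1 != p2 by apply: contraNneq nz12 => ->; rewrite !subrr.
(* A slope [mu] for which none of the three forms is constant along the lines. *)
have [mu [mu12 mu13 mu23]] : exists mu : nat, [/\ (`|(p1 0 1 - p2 0 1)%R| < mu)%N,
   (`|(p1 0 1 - p3 0 1)%R| < mu)%N & (`|(p2 0 1 - p3 0 1)%R| < mu)%N].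
  exists (`|(p1 0 1 - p2 0 1)%R| + `|(p1 0 1 - p3 0 1)%R| + `|(p2 0 1 - p3 0 1)%R|).+1%N.
  exact: lt_sum3.
have l12 := slope_neq0 nz12 mu12; have l13 := slope_neq0 nz13 mu13.
have l23 := slope_neq0 nz23 mu23.
have [K KE] : exists K, K = (2 ^ D)%N by eexists.
have [M ME] : exists M, M = ((2 * K) ^ D)%N by eexists.
have K0 : (0 < K)%N by rewrite KE expn_gt0.
have M0 : (0 < M)%N by rewrite ME expn_gt0 muln_gt0 K0.
have M2 : (M = 2 ^ (D ^ 2 + D))%N.
  by rewrite ME KE -expnS -expnM; congr expn; rewrite mulSn mulnn addnC.
have [n0 Hn0] := triforce_lines (1024 * M ^ 5).
apply: (pdd_le P1 P2 p12) => [|n]; first by rewrite invr_ge0.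
have [p pp] := exists_prime_gt_all [:: n; n0; 16 * M;
  `|(p1 0 1 - p2 0 1 - mu%:Z * (p1 0 0 - p2 0 0))%R|;
  `|(p1 0 1 - p3 0 1 - mu%:Z * (p1 0 0 - p3 0 0))%R|;
  `|(p2 0 1 - p3 0 1 - mu%:Z * (p2 0 0 - p3 0 0))%R|;
  `|cross p1 p2 p1 p3|; `|cross p1 p4 p1 p3|; `|cross p2 p4 p1 p3|]%N.
rewrite /= => /and5P[np n0p Mp l12p /and5P[l13p l23p c123p c143p /andP[c243p _]]].
have F0 (e : int) : e != 0 -> (`|e| < p)%N -> e%:~R != 0 :> 'F_p.
  by move=> e0 ep; apply: contra e0; rewrite intr_Fp_eq0 // => /(dvdn_absz_eq0 ep) ->.
have {l12p} l12F := F0 _ l12 l12p; have {l13p} l13F := F0 _ l13 l13p.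
have {l23p} l23F := F0 _ l23 l23p; have {c123p} c123F := F0 _ c123 c123p.
have {c143p} c143F := F0 _ c143 c143p; have {c243p} c243F := F0 _ c243 c243p.
exists p; split=> //.
have p_gt0 := prime_gt0 pp.
pose w := (p %/ (16 * M))%N.
have M16 : (0 < 16 * M)%N by rewrite muln_gt0.
have wle : (16 * M * w <= p)%N by rewrite mulnC leq_trunc_div.
have w0 : (0 < w)%N by rewrite divn_gt0 // ltnW.
have wge : (p <= 32 * M * w)%N.
  rewrite {1}(divn_eq p (16 * M)) -/w.
  rewrite (_ : 32 * M * w = w * (16 * M) + w * (16 * M))%N; last by ring.
  by rewrite leq_add2l (leq_trans (ltnW (ltn_pmod p M16))) // leq_pmull.
have w4 : (4 * w <= p)%N.
  apply: leq_trans wle; rewrite leq_mul2r; apply/orP; right.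
  by apply: leq_trans (leq_pmulr 16 M0).
have wle' : (4 * 2 ^ 2 * (2 * K) ^ D * w <= p)%N by rewrite -ME.
have [B [cB HB]] := block_set (isT : 0 < 2)%N K0 D0 pp wle'.
pose form (a b : 'rV[int]_2) (z : 'F_p * 'F_p) : 'F_p :=
  z.1 * (a 0 1 - b 0 1)%:~R - z.2 * (a 0 0 - b 0 0)%:~R.
pose h z := form p1 p2 z ^+ 4; pose u z := form p2 p3 z ^+ 2.
pose v z := form p1 p3 z ^+ 7.
pose Phi z (c : 'F_p * 'F_p) := (h z + u z + v z + c.1, 2 * h z + u z + c.2).
pose B2 := finset.setX [set x : 'F_p | (x < w)%N] B.
have wp : (w <= p)%N by apply: leq_trans w4; rewrite leq_pmull.
have Phi_inj z : injective (Phi z).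
  by move=> [s t] [s' t'] /eqP; rewrite xpair_eqE /= !(inj_eq (addrI _)) => /andP[/eqP -> /eqP ->].
have [[c1 c2] Hc] := exists_dense_parameter (0, 0) (unit_square p) B2 Phi_inj.
exists [set z | Phi z (c1, c2) \in B2]; split.
  set t := #|_ :&: _|.
  have Ht : (p.-1 ^ 2 * (w * #|B|) <= p * p * t)%N.
    move: Hc; rewrite card_unit_square // cardsX card_Fp_lt // card_prod card_Fp //.
    move=> /leq_trans; apply; rewrite leq_mul2l; apply/orP; right.
    apply: subset_leq_card; apply/fintype.subsetP => z.
    by rewrite inE => /andP[z1 z2]; rewrite finset.in_setI inE z1 z2.
  have main : (p.-1 ^ 2 <= D * K ^ 2 * 1024 * 2 ^ D * M * t)%N.
    have wK0 : (0 < K ^ D * (w * w))%N by rewrite !(expn_gt0, muln_gt0) K0 w0.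
    rewrite -(leq_pmul2r wK0).
    apply: leq_trans (_ : p.-1 ^ 2 * (w * (D * K ^ 2 * #|B|)) <= _)%N.
      rewrite leq_mul2l (_ : K ^ D * (w * w) = w * (K ^ D * w))%N; last by ring.
      by rewrite leq_mul2l cB !orbT.
    apply: leq_trans (_ : D * K ^ 2 * (p * p * t) <= _)%N.
      rewrite (_ : p.-1 ^ 2 * (w * (D * K ^ 2 * #|B|)) =
        D * K ^ 2 * (p.-1 ^ 2 * (w * #|B|)))%N; last by ring.
      by rewrite leq_mul2l Ht orbT.
    apply: leq_trans (_ : D * K ^ 2 * ((32 * M * w) * (32 * M * w) * t) <= _)%N.
      by rewrite leq_mul2l leq_mul2r leq_mul ?wge ?orbT.
    rewrite leq_eqVlt; apply/orP; left; apply/eqP.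
    transitivity (D * K ^ 2 * 1024 * M * t * (w * w) * (2 ^ D * K ^ D))%N.
      by rewrite -expnMn -ME; ring.
    by ring.
  (* The exponents of [D <= 2^D], [K^2], [1024], [2^D] and [M] add up to [D^2 + 5 D + 10]. *)
  have main2 : (p.-1 ^ 2 <= 2 ^ (D ^ 2 + 5 * D + 10) * t)%N.
    apply: leq_trans main _; rewrite leq_mul2r; apply/orP; right.
    apply: leq_trans (_ : 2 ^ D * K ^ 2 * 1024 * 2 ^ D * M <= _)%N.
      by rewrite !leq_mul2r expn_ge_id2 !orbT.
    rewrite M2 KE -expnM (_ : 1024 = 2 ^ 10)%N // -!expnD leq_exp2l //.
    by clear; lia.
  have h2 : (0 : R) < (2 ^ (D ^ 2 + 5 * D + 10))%:R by rewrite ltr0n expn_gt0.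
  apply: le_trans (ler_wpM2r _ ha) _; first by rewrite exprn_ge0.
  by rewrite mulrC ler_pdivrMr // -natrX -natrM ler_nat mulnC.
move=> d Z d0 HZ.
have bound : (#|Z| * (16 * M ^ 5) <= p * p)%N.
  apply: (@card_le_by_lines p _ mu%:R) => // s.
  apply: (line_count_arith p_gt0 M0 w0 wle).
  pose b (a a' y : 'rV[int]_2) : 'F_p := - (s * (a 0 0 - a' 0 0)%:~R) +
    d * ((residue p y).1 * (a 0 1 - a' 0 1)%:~R - (residue p y).2 * (a 0 0 - a' 0 0)%:~R).
  have formE a a' y t : form a a' (t + d * (residue p y).1, s + mu%:R * t + d * (residue p y).2) =
     (a 0 1 - a' 0 1 - mu%:Z * (a 0 0 - a' 0 0))%:~R * t + b a a' y.
    by rewrite /form /b /= (rmorphB _ (a 0 1 - a' 0 1)) rmorphM /= -pmulrn; ring.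
  (* Changing the point of [P] changes the constant term by [d] times a determinant, so distinct
     constant terms amount to nonparallel directions. *)
  have bE a a' y y' : b a a' y - b a a' y' = d * (cross y y' a a')%:~R.
    by rewrite /b /cross /residue !(rmorphB, rmorphM) /=; ring.
  have bN a a' y y' : (cross y y' a a')%:~R != 0 :> 'F_p -> b a a' y != b a a' y'.
    by move=> cn; rewrite -subr_eq0 bE mulf_neq0.
  have bS a a' : b a a' a' = b a a' a.
    apply/eqP; rewrite -subr_eq0 bE (_ : cross a' a a a' = 0) ?mulr0z ?mulr0 //.
    by rewrite /cross; ring.
  apply: (Hn0 p pp (ltnW n0p) w _ _ _ (b p1 p3 p1) (b p1 p3 p2) (b p1 p3 p4)
    (b p1 p2 p1) (b p1 p2 p3) (b p1 p2 p4) (b p2 p3 p1) (b p2 p3 p2) (b p2 p3 p4) c1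
    _ l13F l12F l23F) => //.
  - exact: bN.
  - exact: bN.
  - exact: bN.
  - apply: bN; rewrite (_ : cross p1 p3 p1 p2 = - cross p1 p2 p1 p3); last by rewrite /cross; ring.
    by rewrite rmorphN oppr_eq0.
  - by apply: bN; rewrite (_ : cross p1 p2 p2 p3 = cross p1 p2 p1 p3) // /cross; ring.
  move=> t; rewrite inE => tZ W H U.
  have T y : y \in P -> ((H (b p1 p2 y) + U (b p2 p3 y) + W (b p1 p3 y) + c1)%R < w)%N /\
      2 * H (b p1 p2 y) + U (b p2 p3 y) + c2 \in B.
    move=> yP; have := HZ _ _ tZ yP; rewrite inE /B2 finset.in_setX inE.
    by rewrite /Phi /h /u /v !formE => /andP[T1 T2]; split; [exact: T1|exact: T2].
  have [T1 B1] := T _ P1; have [T2 B2'] := T _ P2; have [T3 B3] := T _ P3.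
  have [T4 _] := T _ P4.
  rewrite !bS in T2 T3 B2' B3.
  have lt2 x : (x < w)%N -> (x < 2 * w)%N by move=> /leq_trans; apply; rewrite leq_pmull.
  split; try exact: lt2.
  (* The values of [2 h + u] at [p2] and [p3] average to the one at [p1], up to the difference of
     [h + u + v] at [p1] and [p3], in which [v] cancels. As [h] agrees at [p1] and [p2], closeness
     there concerns [u] alone. *)
  have := HB 1%N 1%N 0%N _ _ _ _ _ _ erefl isT B1 B2' B3 B3 T1 T3.
  move: (H (b p1 p2 p1)) (H (b p1 p2 p3)) (U (b p2 p3 p1)) (U (b p2 p3 p2))
    (W (b p1 p3 p1)) => X1 X3 Y1 Y2 V1.
  rewrite (_ : 2 * X1 + Y2 + c2 - (2 * X1 + Y1 + c2) = Y2 - Y1); last by ring.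
  by apply; ring.
have h3 : (p * p <= 4 * p.-1 ^ 2)%N.
  have p_gt1 := prime_gt1 pp.
  have hp : (p <= 2 * p.-1)%N by clear -p_gt1; lia.
  by apply: leq_trans (leq_mul hp hp) _; rewrite leq_eqVlt; apply/orP; left; apply/eqP; ring.
rewrite mulrC -natrX ler_pdivlMr ?ltr0n ?expn_gt0 // -natrM ler_nat.
rewrite (_ : 2 ^ (5 * (D ^ 2 + D)) = M ^ 5)%N; last by rewrite M2 -expnM mulnC.
rewrite -(leq_pmul2l (isT : 0 < 16)%N) mulnCA (leq_trans bound) // (leq_trans h3) //.
by rewrite leq_mul2r orbT.
Qed.

(** * Planar geometry *)

(** Points may repeat and [a2], [a3] may vanish, so a point between two others is included. *)
Definition convex_dependence (P : {fset 'rV[int]_2}) : Prop :=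
  exists (p0 p1 p2 p3 : 'rV[int]_2) (a1 a2 a3 : nat),
    [/\ [/\ p0 \in P, p1 \in P, p2 \in P & p3 \in P], p1 != p0, (0 < a1)%N &
    forall i, a1%:Z * (p1 0 i - p0 0 i) + a2%:Z * (p2 0 i - p0 0 i) +
             a3%:Z * (p3 0 i - p0 0 i) = 0].

Lemma between_convex_dependence (P : {fset 'rV[int]_2}) (q1 q2 q3 : 'rV[int]_2) i :
  q1 \in P -> q2 \in P -> q3 \in P -> q1 0 i < q2 0 i -> q2 0 i < q3 0 i ->
  (forall j, (q3 0 i - q2 0 i) * (q1 0 j - q2 0 j) +
             (q2 0 i - q1 0 i) * (q3 0 j - q2 0 j) = 0) ->
  convex_dependence P.
Proof.
move=> P1 P2 P3 lt12 lt23 E.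
(* The weights are the opposite gaps in coordinate [i]; [q2] itself fills the last place with weight
   0. *)
exists q2, q1, q3, q2, `|(q3 0 i - q2 0 i)%R|%N, `|(q2 0 i - q1 0 i)%R|%N, 0%N; split=> //.
- by apply: contraTneq lt12 => ->; rewrite ltxx.
- by rewrite absz_gt0 subr_eq0 gt_eqF.
move=> j; rewrite !gez0_abs ?subr_ge0 ?ltW // -[RHS](E j).
by rewrite mul0r addr0.
Qed.

(** A coordinate separating [q1] from [q2] separates all three points, and the middle one in that
    coordinate lies between the others. *)
Lemma collinear_convex_dependence (P : {fset 'rV[int]_2}) (q1 q2 q3 : 'rV[int]_2) :
  q1 \in P -> q2 \in P -> q3 \in P -> q1 != q2 -> q1 != q3 -> q2 != q3 ->
  cross q1 q2 q1 q3 = 0 -> convex_dependence P.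
Proof.
move=> P1 P2 P3 q12 q13 q23 cr.
have E i j : (q3 0 i - q2 0 i) * (q1 0 j - q2 0 j) +
             (q2 0 i - q1 0 i) * (q3 0 j - q2 0 j) = 0.
  move: i j; apply: forall_ord2; apply: forall_ord2; first by ring.
  - by rewrite -cr /cross; ring.
  - by rewrite -[RHS]oppr0 -cr /cross; ring.
  - by ring.
have [i i12] : exists i, q1 0 i != q2 0 i.
  apply: contrapT => /forallNP H; move/eqP: q12; apply; apply/rowP => i.
  by apply/eqP; have /negP := H i; rewrite negbK.
have diff (a b c : 'rV[int]_2) : a != b -> (forall j, (c 0 i - a 0 i) * (b 0 j - a 0 j) = 0) ->
    c 0 i = a 0 i.
  move=> ab H; apply: contrapT => /eqP ca; move/eqP: ab; apply; apply/rowP => j.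
  have /eqP := H j; rewrite mulf_eq0 !subr_eq0 (negPf ca) /= => /eqP ->.
  by [].
have i13 : q1 0 i != q3 0 i.
  apply: contra i12 => /eqP e13; apply/eqP/esym.
  apply: (diff _ _ _ q13) => j; have := E i j; rewrite -e13 => <-; ring.
have i23 : q2 0 i != q3 0 i.
  apply: contra i12 => /eqP e23; apply/eqP.
  apply: (diff _ _ _ q23) => j; rewrite -[RHS]oppr0 -(E i j) -e23; ring.
have mono (s : int) (x y : int) : x = 0 -> y = s * x -> y = 0.
  by move=> -> ->; rewrite mulr0.
case: (ltgtP (q1 0 i) (q2 0 i)) i12 => // lt12 _;
case: (ltgtP (q1 0 i) (q3 0 i)) i13 => // lt13 _;
case: (ltgtP (q2 0 i) (q3 0 i)) i23 => // lt23 _.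
- by apply: (between_convex_dependence P1 P2 P3 lt12 lt23).
- by apply: (between_convex_dependence P1 P3 P2 lt13 lt23) => j;
  apply: (mono (-1) _ _ (E i j)); ring.
- by have := lt_trans lt12 (lt_trans lt23 lt13); rewrite ltxx.
- by apply: (between_convex_dependence P3 P1 P2 lt13 lt12) => j;
  apply: (mono 1 _ _ (E i j)); ring.
- by apply: (between_convex_dependence P2 P1 P3 lt12 lt13) => j;
  apply: (mono (-1) _ _ (E i j)); ring.
- by have := lt_trans lt12 (lt_trans lt13 lt23); rewrite ltxx.
- by apply: (between_convex_dependence P2 P3 P1 lt23 lt13) => j;
  apply: (mono 1 _ _ (E i j)); ring.
- by apply: (between_convex_dependence P3 P2 P1 lt23 lt12) => j;
  apply: (mono (-1) _ _ (E i j)); ring.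
Qed.

Section RealPoints.
Variable R : realType.
Implicit Types (P : {fset 'rV[int]_2}) (p : 'rV[int]_2).

Notation toR := (map_mx (fun k : int => k%:~R : R)).

Lemma toR_inj : injective (toR : 'rV[int]_2 -> 'rV[R]_2).
Proof.
move=> x y /rowP E; apply/rowP => i; have := E i; rewrite !mxE => /eqP.
by rewrite eqr_int => /eqP.
Qed.

Lemma mem_real_points P p : (toR p \in real_points R P) = (p \in P).
Proof.
apply/imfsetP/idP => [[q /= qP /toR_inj -> //]|pP]; by exists p.
Qed.

Lemma collinear_cross (T : {fset 'rV[R]_2}) (q1 q2 q3 : 'rV[int]_2) :
  collinear T -> toR q1 \in T -> toR q2 \in T -> toR q3 \in T ->
  cross q1 q2 q1 q3 = 0.
Proof.
move=> [p [v [_ H]]] /H[t1 /rowP E1] /H[t2 /rowP E2] /H[t3 /rowP E3].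
apply/eqP; rewrite -(eqr_int R); apply/eqP.
have [E10 E11] := (E1 0, E1 1); have [E20 E21] := (E2 0, E2 1).
have [E30 E31] := (E3 0, E3 1).
rewrite !mxE in E10 E11 E20 E21 E30 E31.
by rewrite /cross !(rmorphB, rmorphM) /= E10 E11 E20 E21 E30 E31; ring.
Qed.

Lemma cross_collinear (q1 q2 q3 : 'rV[int]_2) : q1 != q2 ->
  cross q1 q2 q1 q3 = 0 ->
  collinear [fset x in [:: toR q1; toR q2; toR q3]]%fset.
Proof.
move=> q12 cr; exists (toR q1), (toR q2 - toR q1); split.
  by rewrite subr_eq0 (inj_eq toR_inj) eq_sym.
have crR : (q1 0 0 - q2 0 0)%:~R * (q1 0 1 - q3 0 1)%:~R =
           (q1 0 1 - q2 0 1)%:~R * (q1 0 0 - q3 0 0)%:~R :> R.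
  by rewrite -!rmorphM; congr (_%:~R); apply/eqP; rewrite -subr_eq0 -/(cross q1 q2 q1 q3) cr.
move=> x; rewrite !inE ?orbF => /or3P[] /eqP ->.
- by exists 0; rewrite scale0r addr0.
- by exists 1; rewrite scale1r addrC subrK.
have [e0|e0] := eqVneq (q1 0 0) (q2 0 0).
  have e1 : (q1 0 1 - q2 0 1)%:~R != 0 :> R.
    rewrite intr_eq0 subr_eq0; apply: contra q12 => /eqP e1.
    by apply/eqP; exact: rV2P.
  exists ((q1 0 1 - q3 0 1)%:~R / (q1 0 1 - q2 0 1)%:~R); apply: rV2P; rewrite !mxE.
    move/eqP: crR; rewrite e0 subrr mulr0z mul0r eq_sym mulf_eq0 (negPf e1) /=.
    by rewrite intr_eq0 subr_eq0 => /eqP ->; rewrite subrr mulr0 addr0.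
  by move: e1; rewrite !rmorphB /= => e1; field.
have e1 : (q1 0 0 - q2 0 0)%:~R != 0 :> R by rewrite intr_eq0 subr_eq0.
exists ((q1 0 0 - q3 0 0)%:~R / (q1 0 0 - q2 0 0)%:~R); apply: rV2P; rewrite !mxE.
  by move: e1; rewrite !rmorphB /= => e1; field.
have -> : (q2 0 1)%:~R - (q1 0 1)%:~R = - (q1 0 1 - q2 0 1)%:~R :> R by rewrite rmorphB /=; ring.
rewrite mulrN mulrAC -[X in X / _]mulrC -crR mulrAC mulfV // mul1r rmorphB /=; ring.
Qed.

(** Real barycentric coordinates become integers by Cramer's rule: [w_k Dt] is a determinant [D_k]
    of integer points, and all [D_k] have the sign of [Dt]. If [Dt = 0], the three other points are
    collinear. *)
Lemma conv_hull_convex_dependence P p0 : #|` P| = 4%N -> p0 \in P ->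
  conv_hull (real_points R P `\ toR p0)%fset (toR p0) -> convex_dependence P.
Proof.
move=> cP P0 [w [w_ge0 w_sum w_comb]].
have : size (P `\ p0)%fset = 3%N by have := cardfsD1 p0 P; rewrite cP P0 => -[].
have memP y : (y \in enum_fset (P `\ p0)%fset) = (y != p0) && (y \in P) by rewrite !inE.
have := fset_uniq (P `\ p0)%fset.
case E : (enum_fset (P `\ p0)%fset) memP => [|p1 [|p2 [|p3 [|]]]] // memP /=.
rewrite !inE => /andP[/norP[p12 p13] /andP[p23 _]] _.
have /andP[p10 P1] : (p1 != p0) && (p1 \in P) by rewrite -memP !inE eqxx.
have /andP[p20 P2] : (p2 != p0) && (p2 \in P) by rewrite -memP !inE eqxx orbT.
have /andP[p30 P3] : (p3 != p0) && (p3 \in P) by rewrite -memP !inE eqxx !orbT.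
have pe : perm_eq (enum_fset (real_points R P `\ toR p0)%fset) [seq toR y | y <- [:: p1; p2; p3]].
  apply: uniq_perm; first exact: fset_uniq.
    by rewrite map_inj_uniq ?/= ?inE ?negb_or ?p12 ?p13 ?p23 //; exact: toR_inj.
  move=> x; apply/idP/mapP => [|[y yp ->]].
    rewrite !inE => /andP[xp /imfsetP[y /= yP xE]]; exists y => //.
    by rewrite memP yP andbT; apply: contra xp => /eqP <-; rewrite xE.
  by move: yp; rewrite memP => /andP[y0 yP]; rewrite !inE (inj_eq toR_inj) y0 mem_real_points.
rewrite (perm_big _ pe) /= !big_cons big_nil addr0 in w_sum.
rewrite (perm_big _ pe) /= !big_cons big_nil addr0 in w_comb.
have w1 : 0 <= w (toR p1) by apply: w_ge0; rewrite !inE (inj_eq toR_inj) p10 mem_real_points.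
have w2 : 0 <= w (toR p2) by apply: w_ge0; rewrite !inE (inj_eq toR_inj) p20 mem_real_points.
have w3 : 0 <= w (toR p3) by apply: w_ge0; rewrite !inE (inj_eq toR_inj) p30 mem_real_points.
move: (w (toR p1)) (w (toR p2)) (w (toR p3)) w1 w2 w3 w_sum w_comb => w1 w2 w3 w1_ge0 w2_ge0 w3_ge0.
move=> w_sum /rowP wE; have [wE0 wE1] := (wE 0, wE 1); rewrite !mxE in wE0 wE1.
have w1E : w1 = 1 - w2 - w3 by rewrite -w_sum; ring.
set Dt := cross p1 p2 p1 p3.
have [cr|Dn0] := eqVneq Dt 0; first exact: (collinear_convex_dependence P1 P2 P3).
pose D1 := cross p2 p0 p3 p0; pose D2 := cross p3 p0 p1 p0; pose D3 := cross p1 p0 p2 p0.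
have D1E : D1%:~R = w1 * Dt%:~R.
  by rewrite /D1 /Dt /cross !(rmorphB, rmorphM) /= wE0 wE1 w1E; ring.
have D2E : D2%:~R = w2 * Dt%:~R.
  by rewrite /D2 /Dt /cross !(rmorphB, rmorphM) /= wE0 wE1 w1E; ring.
have D3E : D3%:~R = w3 * Dt%:~R.
  by rewrite /D3 /Dt /cross !(rmorphB, rmorphM) /= wE0 wE1 w1E; ring.
have Dsum : D1 + D2 + D3 = Dt by rewrite /D1 /D2 /D3 /Dt /cross; ring.
have rel : forall i, D1 * (p1 0 i - p0 0 i) + D2 * (p2 0 i - p0 0 i) +
    D3 * (p3 0 i - p0 0 i) = 0.
  by apply: forall_ord2; rewrite /D1 /D2 /D3 /cross; ring.
have absE (Dk : int) (wk : R) : 0 <= wk -> Dk%:~R = wk * Dt%:~R ->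
    `|Dk|%N%:Z = sgz Dt * Dk.
  move=> wk0 DkE; have [Dt0|Dt0] := ltrP 0 Dt.
    by rewrite gtr0_sgz // mul1r gez0_abs // -(ler0z R) DkE mulr_ge0 // ler0z ltW.
  have {}Dt0 : Dt < 0 by rewrite lt_neqAle Dn0.
  by rewrite ltr0_sgz // mulN1r lez0_abs // -(lerz0 R) DkE mulr_ge0_le0 // lerz0 ltW.
have relA i : `|D1|%N%:Z * (p1 0 i - p0 0 i) + `|D2|%N%:Z * (p2 0 i - p0 0 i) +
    `|D3|%N%:Z * (p3 0 i - p0 0 i) = 0.
  rewrite (absE _ _ w1_ge0 D1E) (absE _ _ w2_ge0 D2E) (absE _ _ w3_ge0 D3E).
  by rewrite -[RHS](mulr0 (sgz Dt)) -(rel i); ring.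
(* Some [D_k] is nonzero because their sum is [Dt]; its point takes the first place. *)
have [D10|D1n0] := posnP `|D1|%N; last by exists p0, p1, p2, p3, `|D1|%N, `|D2|%N, `|D3|%N.
have [D20|D2n0] := posnP `|D2|%N; last first.
  exists p0, p2, p1, p3, `|D2|%N, `|D1|%N, `|D3|%N; split => // i.
  by rewrite -[RHS](relA i); ring.
have [D30|D3n0] := posnP `|D3|%N; last first.
  exists p0, p3, p1, p2, `|D3|%N, `|D1|%N, `|D2|%N; split => // i.
  by rewrite -[RHS](relA i); ring.
move/eqP: Dn0; case; rewrite -Dsum; clear -D10 D20 D30.
by move: D1 D2 D3 D10 D20 D30 => x y z; lia.
Qed.

Lemma not_convex_dependence P : #|` P| = 4%N ->
  ~ strict_convex_position (real_points R P) -> convex_dependence P.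
Proof.
move=> cP /not_andP[/existsNP[T /not_implyP[TS /not_implyP[cT /contrapT col]]]|].
  have : size T = 3%N by [].
  have := fset_uniq T; have TP y : y \in enum_fset T -> exists2 q, q \in P & y = toR q.
    by move=> yT; have /imfsetP[q /= qP ->] := fsubsetP TS _ yT; exists q.
  case E : (enum_fset T) TP => [|x1 [|x2 [|x3 [|]]]] // TP /=.
  rewrite !inE => /andP[/norP[x12 x13] /andP[x23 _]] _.
  have TE y : (y \in T) = (y \in [:: x1; x2; x3]) by rewrite -E.
  have [q1 P1 E1] : exists2 q, q \in P & x1 = toR q by apply: TP; rewrite !inE eqxx.
  have [q2 P2 E2] : exists2 q, q \in P & x2 = toR q by apply: TP; rewrite !inE eqxx orbT.
  have [q3 P3 E3] : exists2 q, q \in P & x3 = toR q by apply: TP; rewrite !inE eqxx !orbT.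
  rewrite E1 E2 E3 !(inj_eq toR_inj) in x12 x13 x23.
  apply: (collinear_convex_dependence P1 P2 P3 x12 x13 x23).
  by apply: (collinear_cross col); rewrite TE !inE ?E1 ?E2 ?E3 eqxx ?orbT.
move=> /existsNP[x /not_implyP[xS /contrapT]].
have /imfsetP[p0 /= P0 ->] := xS.
exact: conv_hull_convex_dependence.
Qed.

(* Of the three ways to split four points into two pairs, at most two give parallel lines. *)
Lemma convex_position_labels P : #|` P| = 4%N ->
  strict_convex_position (real_points R P) ->
  exists p1 p2 p3 p4, [/\ p1 \in P, p2 \in P, p3 \in P & p4 \in P] /\
   [/\ cross p1 p2 p1 p3 != 0, cross p1 p4 p1 p3 != 0 & cross p2 p4 p1 p3 != 0].
Proof.
move=> cP [noncol _].
have nc q1 q2 q3 : q1 \in P -> q2 \in P -> q3 \in P ->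
    q1 != q2 -> q1 != q3 -> q2 != q3 -> cross q1 q2 q1 q3 != 0.
  move=> P1 P2 P3 q12 q13 q23; apply/eqP => /(cross_collinear q12).
  apply: noncol.
    apply/fsubsetP => x; rewrite !inE ?orbF.
    by move=> /or3P[] /eqP ->; rewrite mem_real_points.
  rewrite card_fseq undup_id //= !inE !(inj_eq toR_inj) negb_or q12 q13 q23 //.
have : size P = 4%N by [].
have := fset_uniq P; have memP y : (y \in P) = (y \in enum_fset P) by [].
case E : (enum_fset P) memP => [|q1 [|q2 [|q3 [|q4 [|]]]]] // memP /=.
rewrite !inE => /and4P[/norP[n12 /norP[n13 n14]] /norP[n23 n24] n34 _] _.
have P1 : q1 \in P by rewrite memP !inE eqxx.
have P2 : q2 \in P by rewrite memP !inE eqxx !orbT.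
have P3 : q3 \in P by rewrite memP !inE eqxx !orbT.
have P4 : q4 \in P by rewrite memP !inE eqxx !orbT.
have [X|X] := eqVneq (cross q2 q4 q1 q3) 0; last first.
  by exists q1, q2, q3, q4; split=> //; split=> //; apply: nc => //; rewrite eq_sym.
have [Y|Y] := eqVneq (cross q3 q4 q1 q2) 0; last first.
  by exists q1, q3, q2, q4; split=> //; split=> //; apply: nc => //; rewrite eq_sym.
have [Z|Z] := eqVneq (cross q2 q3 q1 q4) 0; last first.
  by exists q1, q2, q4, q3; split=> //; split=> //; apply: nc => //; rewrite eq_sym.
have /eqP[] := nc _ _ _ P1 P2 P3 n12 n13 n23.
(* Three parallel splittings would make the triangle [q1 q2 q3] degenerate. *)
have : 2 * cross q1 q2 q1 q3 = 0.
  transitivity (cross q3 q4 q1 q2 - cross q2 q4 q1 q3 - cross q2 q3 q1 q4).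
    by rewrite /cross; ring.
  by rewrite X Y Z.
by move/eqP; rewrite mulf_eq0 => /orP[|/eqP].
Qed.

End RealPoints.

(** * Asymptotics *)

(** The translates inject into [T], which is half of the unit square. This trivial bound covers
    densities too large for the Behrend construction. *)
Lemma pdd_le_half (R : realType) (P : {fset 'rV[int]_2}) (y1 y2 : 'rV[int]_2)
    (alpha : R) :
  y1 \in P -> y2 \in P -> y1 != y2 -> alpha <= 2^-1 -> pdd P alpha <= 2^-1.
Proof.
move=> P1 P2 y12 ha; apply: (pdd_le P1 P2 y12) => [|n]; first by rewrite invr_ge0.
have [p pp pn] := exists_large_prime (n + 2); exists p; split=> //.
  exact: leq_ltn_trans (leq_addr _ _) pn.
have p2 : (2 < p)%N by apply: leq_ltn_trans pn; exact: leq_addl.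
have [k pE] : exists k, p = (2 * k).+1.
  exists p./2; case: (even_prime pp) => [p2'|od]; first by rewrite p2' in p2.
  by rewrite -[LHS]odd_double_half od mul2n.
pose S := [set x : 'F_p | (x < k.+1)%N] :\ 0.
have cS : #|S| = k.
  have kp : (k.+1 <= p)%N by rewrite pE ltnS leq_pmull.
  have := cardsD1 0 [set x : 'F_p | (x < k.+1)%N].
  by rewrite card_Fp_lt // inE /= add1n => -[].
pose T : {set 'F_p * 'F_p} := finset.setX S [set~ 0].
have cT : #|T| = (k * p.-1)%N by rewrite cardsX cS cardsC1 card_Fp.
have half : #|T|%:R = 2^-1 * p.-1%:R ^+ 2 :> R.
  by rewrite cT pE /= natrM natrM; field.
exists T; split.
  have -> : T :&: unit_square p = T.
    apply/finset.setIidPl/fintype.subsetP => -[x y].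
    by rewrite !inE /= => /andP[/andP[-> _] ->].
  by rewrite half ler_wpM2r // exprn_ge0.
move=> d Z d0 HZ; rewrite -half ler_nat.
pose f (z : 'F_p * 'F_p) := (z.1 + d * (residue p y1).1, z.2 + d * (residue p y1).2).
have finj : injective f.
  move=> [s t] [s' t'] /eqP; rewrite xpair_eqE /= !(inj_eq (addIr _)).
  by move=> /andP[/eqP -> /eqP ->].
rewrite -(card_imset _ finj); apply: subset_leq_card.
by apply/fintype.subsetP => _ /imsetP[z zZ ->]; exact: HZ.
Qed.

Local Open Scope classical_set_scope.
Local Open Scope ring_scope.

Section Asymptotics.
Variable R : realType.

Lemma expR_ln2_nat (n : nat) : (2 ^ n)%:R^-1 = expR (- (n%:R * ln 2)) :> R.
Proof. by rewrite expRN expRM_natl lnK ?posrE ?ltr0n // natrX. Qed.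

Lemma ln2_gt0 : 0 < ln 2 :> R.
Proof. by rewrite ln_gt0 // ltr1n. Qed.

Lemma sqr_log_decay (f : R -> R) (Q : nat) : (1 < Q)%N ->
  (forall a, a <= 2^-1 -> f a <= 2^-1) ->
  (forall a D, (0 < D)%N -> a <= (Q ^ D)%:R^-1 -> f a <= 2 / (2 ^ (D ^ 2))%:R) ->
  exists2 c : R, 0 < c &
    forall a : R, 0 < a < 1 / 2 -> f a < a `^ (c * ln (1 / a)).
Proof.
move=> Q1 f_half f_dec.
pose q : R := ln Q%:R.
have q0 : 0 < q by rewrite ln_gt0 // ltr1n.
(* The 5 serves both ranges: [L < 2 q] gives [L^2 < 5 q^2], and [D >= 2] gives
   [(D + 1)^2 <= 5 (D^2 - 1)], the [- 1] coming from the factor 2 in [f_dec]. *)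
pose c : R := ln 2 / (5 * q ^+ 2).
have c0 : 0 < c by rewrite divr_gt0 ?ln2_gt0 // mulr_gt0 ?exprn_gt0.
exists c => // a /andP[a0 a2].
pose L := - ln a.
have L0 : 0 < L.
  by rewrite oppr_gt0 ln_lt0 // a0 (lt_trans a2) // div1r invf_lt1 ?ltr1n.
have -> : a `^ (c * ln (1 / a)) = expR (- (c * L ^+ 2)).
  rewrite /powR gt_eqF // div1r lnV ?posrE // -/L.
  by congr expR; rewrite /L; ring.
have aE : a = expR (- L) by rewrite /L opprK lnK ?posrE.
have cq : c * (5 * q ^+ 2) = ln 2.
  by rewrite /c divfK // mulf_neq0 ?expf_neq0 ?gt_eqF.
have [L2q|L2q] := ltP L (2 * q).
  apply: le_lt_trans (f_half a _) _; first by rewrite -div1r ltW.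
  have -> : 2^-1 = expR (- ln 2) :> R by rewrite expRN lnK ?posrE ?ltr0n.
  rewrite ltr_expR ltrN2 -cq ltr_pM2l //.
  by nra.
pose D := Num.trunc (L / q).
have /andP[D_le D_gt] : D%:R <= L / q < D.+1%:R.
  by apply: truncn_itv; rewrite divr_ge0 ?ltW.
rewrite ler_pdivlMr // in D_le; rewrite ltr_pdivrMr // in D_gt.
have D2 : (2 <= D)%N.
  rewrite -ltnS -(ltr_nat R) -(ltr_pM2r q0).
  by apply: le_lt_trans L2q D_gt.
apply: le_lt_trans (f_dec a D _ _) _; first exact: ltnW.
  have QE : Q%:R = expR q by rewrite lnK // posrE ltr0n ltnW.
  by rewrite natrX QE -expRM_natl -expRN {1}aE ler_expR lerN2.
have -> : 2 / (2 ^ D ^ 2)%:R = expR (- (((D%:R : R) ^+ 2 - 1) * ln 2)).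
  rewrite expR_ln2_nat -{1}[2](@lnK R) ?posrE ?ltr0n // -expRD natrX.
  by congr expR; ring.
rewrite ltr_expR ltrN2 -cq.
have D2R : 2 <= D%:R :> R by rewrite ler_nat.
have -> : ((D%:R : R) ^+ 2 - 1) * (c * (5 * q ^+ 2)) = c * (5 * ((D%:R ^+ 2 - 1) * q ^+ 2)) by ring.
rewrite ltr_pM2l //.
rewrite -natr1 in D_gt.
have h1 : L ^+ 2 < ((D%:R + 1) * q) ^+ 2 by rewrite ltr_pXn2r // nnegrE ltW // (lt_trans L0).
apply: lt_le_trans h1 _.
have -> : 5 * ((D%:R ^+ 2 - 1) * q ^+ 2) = (5 * (D%:R ^+ 2 - 1)) * q ^+ 2 :> R by ring.
rewrite exprMn ler_wpM2r ?sqr_ge0 //.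
by nra.
Qed.

Lemma quadratic_sandwich (n : nat) : (10 <= n)%N ->
  exists D, (D ^ 2 + 5 * D + 10 <= n < D.+1 ^ 2 + 5 * D.+1 + 10)%N.
Proof.
elim: n => // n IH; rewrite leq_eqVlt => /orP[/eqP <-|]; first by exists 0%N.
rewrite ltnS => /IH[D /andP[h1 h2]].
have [h|h] := ltnP n.+1 (D.+1 ^ 2 + 5 * D.+1 + 10)%N.
  by exists D; rewrite h andbT ltnW.
exists D.+1; rewrite h /=; apply: leq_ltn_trans h2 _.
by rewrite !ltn_add2r; nia.
Qed.

(** For [D] maximal with [D^2 + 5 D + 10 <= log_2 (1 / a)], the exponents differ from [5 D^2] by
    terms linear in [D], which [e D^2] absorbs. The factor 2 prepares a strict inequality. *)
Lemma power5_decay (f : R -> R) :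
  (forall a D, (0 < D)%N -> a <= (2 ^ (D ^ 2 + 5 * D + 10))%:R^-1 ->
     f a <= (2 ^ (5 * (D ^ 2 + D)))%:R^-1) ->
  forall e : R, 0 < e -> exists2 a0 : R, 0 < a0 < 1 &
    forall a, 0 < a < a0 -> 2 * f a <= expR ((5 - e) * ln a).
Proof.
move=> f_dec e e0.
(* The final comparison needs [30 x + 81 <= e x^2] for [x = D]; since [x >= 1], it follows from
   [111 <= e x]. *)
pose D0 := (Num.trunc (111 / e)).+1.
have D0e : 111 / e < D0%:R by apply: truncnS_gt.
exists (2 ^ (D0 ^ 2 + 5 * D0 + 10))%:R^-1.
  rewrite invr_gt0 ltr0n expn_gt0 /= invf_lt1 ?ltr0n ?expn_gt0 //.
  by rewrite ltr1n -{1}(expn0 2) ltn_exp2l // addn_gt0 orbT.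
move=> a /andP[a0 aD0].
pose y := - ln a / ln 2.
have yE : ln a = - (y * ln 2).
  by rewrite /y divfK ?opprK // gt_eqF // ln2_gt0.
have aE : a = expR (- (y * ln 2)) by rewrite -yE lnK ?posrE.
have y_gt : (D0 ^ 2 + 5 * D0 + 10)%:R < y.
  by move: aD0; rewrite expR_ln2_nat {1}aE ltr_expR ltrN2 ltr_pM2r ?ln2_gt0.
have y0 : 0 <= y by apply: le_trans (ltW y_gt).
have /andP[n_le n_gt] := truncn_itv y0.
have [|D /andP[D_le D_gt]] := @quadratic_sandwich (Num.trunc y).
  rewrite -ltnS -(ltr_nat R); apply: lt_trans n_gt; apply: le_lt_trans y_gt.
  by rewrite ler_nat leq_addl.
have DD0 : (D0 <= D)%N.
  rewrite leqNgt; apply/negP => lt_DD0.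
  have : (D.+1 ^ 2 + 5 * D.+1 + 10 <= D0 ^ 2 + 5 * D0 + 10)%N.
    by rewrite leq_add2r leq_add ?leq_mul2l ?leq_sqr ?lt_DD0 ?orbT.
  by move=> /(leq_trans D_gt); rewrite ltnNge truncn_ge_nat // ltW.
have D1 : (0 < D)%N by apply: leq_trans DD0.
have y_lt : y < (D.+1 ^ 2 + 5 * D.+1 + 10)%:R.
  by apply: lt_le_trans n_gt _; rewrite ler_nat.
have D_y : (D ^ 2 + 5 * D + 10)%:R <= y by apply: le_trans n_le; rewrite ler_nat.
have f_le := f_dec a D D1; rewrite !expR_ln2_nat {1}aE ler_expR lerN2 in f_le.
rewrite ler_pM2r ?ln2_gt0 // in f_le.
have {}f_le := f_le D_y.
apply: le_trans (ler_wpM2l _ f_le) _ => //.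
rewrite -{1}[2](@lnK R) ?posrE ?ltr0n // -expRD ler_expR yE.
have -> : ln 2 - (5 * (D ^ 2 + D))%:R * ln 2 = (1 - 5 * (D%:R ^+ 2 + D%:R)) * ln 2 :> R.
  by rewrite natrM natrD natrX; ring.
have -> : (5 - e) * - (y * ln 2) = - ((5 - e) * y) * ln 2 by ring.
rewrite ler_pM2r ?ln2_gt0 //.
have D1R : 1 <= D%:R :> R by rewrite ler1n.
have eD : 111 <= e * D%:R.
  rewrite mulrC -ler_pdivrMr //; apply: le_trans (ltW D0e) _.
  by rewrite ler_nat.
rewrite !natrD natrX natrM -natr1 in y_lt.
move: (D%:R : R) D1R eD y_lt => x x1 ex y_lt.
have [e5|e5] := leP 5 e; first by nra.
have h1 : (5 - e) * y <= (5 - e) * ((x + 1) ^+ 2 + 5 * (x + 1) + 10).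
  by apply: ler_wpM2l; [rewrite subr_ge0 ltW|exact: ltW].
have h2 : 111 * x <= e * x * x by rewrite ler_wpM2r // (le_trans _ x1).
have h3 : 0 <= e * x by rewrite mulr_ge0 ?ltW // (lt_le_trans _ x1).
nra.
Qed.

(** [eta] solves [m a = a^(5 - eta a)], where [m] strictly dominates [f] thanks to its factor 2. *)
Lemma exponent_function (f : R -> R) :
  (forall e : R, 0 < e -> exists2 a0 : R, 0 < a0 < 1 &
    forall a, 0 < a < a0 -> 2 * f a <= expR ((5 - e) * ln a)) ->
  exists eta : R -> R, eta alpha @[alpha --> 0^'+] --> (0 : R) /\
    forall a, 0 < a < 1 -> f a < a `^ (5 - eta a).
Proof.
move=> f_small.
(* The maximum with [a ^+ 5] makes [eta] nonnegative, even where [f] is too small. *)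
pose m a := 2 * Num.max (f a) (a ^+ 5).
have m0 a : 0 < a -> 0 < m a.
  by move=> a0; rewrite mulr_gt0 // lt_max exprn_gt0 ?orbT.
exists (fun a => 5 - ln (m a) / ln a); split; last first.
  move=> a /andP[a0 a1]; have la0 : ln a < 0 by rewrite ln_lt0 // a0.
  rewrite subKr /powR gt_eqF // divfK ?lt_eqF // lnK ?posrE ?m0 //.
  have : 0 < Num.max (f a) (a ^+ 5) by rewrite lt_max exprn_gt0 ?orbT.
  have : f a <= Num.max (f a) (a ^+ 5) by rewrite le_max lexx.
  by rewrite /m; lra.
apply/cvgrPdist_le => e e0.
have [a1 /andP[a1_gt0 a1_lt1] Ha1] := f_small e e0.
near=> a.
have a0 : 0 < a by near: a; exact: nbhs_right_gt.
have aa1 : a < a1 by near: a; exact: nbhs_right_lt.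
(* This makes [2 a^5 <= a^(5 - e)]. *)
have ae : a < expR (- (ln 2 / e)) by near: a; apply: nbhs_right_lt; rewrite expR_gt0.
have la0 : ln a < 0 by rewrite ln_lt0 // a0 (lt_trans aa1).
have la_e : ln a < - (ln 2 / e) by rewrite -(expRK (- (ln 2 / e))) ltr_ln ?posrE ?expR_gt0.
have lm : ln (m a) <= (5 - e) * ln a.
  rewrite -(expRK ((5 - e) * ln a)) ler_ln ?posrE ?expR_gt0 ?m0 //.
  rewrite /m maxr_pMr // ge_max Ha1 ?a0 //=.
  have -> : 2 * a ^+ 5 = expR (ln 2 + 5 * ln a).
    by rewrite expRD lnK ?posrE ?ltr0n // expRM_natl lnK.
  rewrite ler_expR.
  have : ln 2 <= - ln a * e by rewrite -ler_pdivrMr // lerNr ltW.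
  by lra.
have lm5 : 5 * ln a <= ln (m a).
  rewrite -[5 * ln a]expRK expRM_natl lnK ?posrE // ler_ln ?posrE ?exprn_gt0 ?m0 //.
  have : a ^+ 5 <= Num.max (f a) (a ^+ 5) by rewrite le_max lexx orbT.
  have : 0 < a ^+ 5 by rewrite exprn_gt0.
  by rewrite /m; lra.
rewrite sub0r normrN ger0_norm.
  rewrite lerBlDr -lerBlDl ler_ndivlMr //.
by rewrite subr_ge0 ler_ndivrMr.
Unshelve. all: by end_near.
Qed.

End Asymptotics.

Theorem theorem1p8 (R : realType) (P : {fset 'rV[int]_2})
    (cardP : #|` P| = 4%N) :
  (strict_convex_position (real_points R P) ->
     exists eta : R -> R,
       eta alpha @[alpha --> 0^'+] --> (0 : R) /\
       forall alpha : R, 0 < alpha < 1 ->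
         pdd P alpha < alpha `^ (5 - eta alpha)) /\
  (~ strict_convex_position (real_points R P) ->
     exists2 c : R, 0 < c &
       forall alpha : R, 0 < alpha < 1 / 2 ->
         pdd P alpha < alpha `^ (c * ln (1 / alpha))).
Proof.
split=> [convex|/(not_convex_dependence cardP)].
  have [p1 [p2 [p3 [p4 [[P1 P2 P3 P4] [c123 c143 c243]]]]]] :=
    convex_position_labels cardP convex.
  apply: exponent_function; apply: power5_decay => a D D0.
  exact: (pdd_convex_le P1 P2 P3 P4).
move=> [p0 [p1 [p2 [p3 [a1 [a2 [a3 [[P0 P1 P2 P3] p10 a10 rel]]]]]]]].
apply: (@sqr_log_decay _ _ (64 * (a1 + a2 + a3) ^ 3)%N).
- by rewrite (leq_trans _ (leq_pmulr 64 _)) // expn_gt0 !addn_gt0 a10.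
- by move=> a; exact: (pdd_le_half P1 P0 p10).
- by move=> a D D0; exact: (pdd_nonconvex_le P0 P1 P2 P3).
Qed.
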